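(* Let $m\ge 1$ be an integer, let $D\subset\mathbb{R}^2$ be a compact convex domain, let $V_1,V_2,V_3\in D$ be the vertices of a non-degenerate triangle, and let $f\in C^{m,1}(D)$. Then for each $\boldsymbol{x}\in D$ $$P_{m}^{[\Delta_2(V_1,V_2,V_3);V_1]}[f](\boldsymbol{x})=T_m[f,V_1](\boldsymbol{x})+\delta_{m}^{[\Delta_2(V_1,V_2,V_3);V_1]}[f](\boldsymbol{x}),$$ where $T_m[f,V_1]$ is the Taylor polynomial of order $m$ of $f$ at $V_1$ and $$\begin{aligned}\delta_{m}^{[\Delta_2(V_1,V_2,V_3);V_1]}[f](\boldsymbol{x})=&\sum_{j=1}^{m}\int_0^1\frac{D_{31}^{m-j+2}D_1^{(0,j-1)}f(V_1+t(V_3-V_1))(1-t)^{m-j+1}}{(m-j+1)!}\,dt\ \frac{S_j(\lambda_2+\lambda_3)}{j!}\\ &+\sum_{i=1}^{m}\sum_{j=1}^{m-i+1}\Big((-1)^{i+j}\int_0^1\frac{D_{21}^{m-j-i+3}D_2^{(j-1,i-1)}f(V_1+t(V_2-V_1))(1-t)^{m-j-i+2}}{(m-j-i+2)!}\,dt\\ &\qquad+(-1)^{j}\int_0^1\frac{D_{31}^{m-j-i+3}D_3^{(j-1,i-1)}f(V_1+t(V_3-V_1))(1-t)^{m-j-i+2}}{(m-j-i+2)!}\,dt\Big)\\ &\qquad\times\frac{(\lambda_2+\lambda_3)^{i-1}S_i\!\left(\frac{\lambda_2}{\lambda_2+\lambda_3}\right)}{i!}\,\frac{S_j(\lambda_2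+\lambda_3)}{j!}.\end{aligned}$$
   Context: Function classes. $C^m(D)$ is the class of functions of class $C^m$ on $D$ in the sense of Whitney (restrictions to $D$ of $C^m$ functions on $\mathbb{R}^2$; partial derivatives up to order $m$ are well defined on $D$ since $D$ is convex with nonempty interior). $C^{m,1}(D)$ is the class of $f\in C^m(D)$ whose partial derivatives $\frac{\partial^m f}{\partial x^{m-j}\partial y^j}$, $j=0,\dots,m$, are Lipschitz continuous on $D$. Triangle notation. $V_i=(x_i,y_i)$, $i=1,2,3$. $A(P,Q,R)$ is the determinant of the $3\times3$ matrix whose columns are $(1,P)^T,(1,Q)^T,(1,R)^T$. The barycentric coordinates of $\boldsymbol{x}\in\mathbb{R}^2$ are $\lambda_1=\frac{A(\boldsymbol{x},V_2,V_3)}{A(V_1,V_2,V_3)}$, $\lambda_2=\frac{A(V_1,\boldsymbol{x},V_3)}{A(V_1,V_2,V_3)}$, $\lambda_3=\frac{A(V_1,V_2,\boldsymbol{x})}{A(V_1,V_2,V_3)}$. $\Delta_2(V_1,V_2,V_3)$ is the convex hull of $V_1,V_2,V_3$. For $i\ne j$, $D_{ij}f(\boldsymbol{x})=(V_i-V_j)\cdot\nabla f(\boldsymbol{x})$, and for $\beta=(\beta_1,\beta_2)$ with non-negative integer components, $D_1^\beta=D_{21}^{\beta_1}D_{31}^{\beta_2}$, $D_2^\beta=D_{12}^{\beta_1}D_{32}^{\beta_2}$, $D_3^\beta=D_{13}^{\beta_1}D_{23}^{\beta_2}$. Bernoulli polynomials. $B_0(x)=1$, $B_n'(x)=nB_{n-1}(x)$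 and $\int_0^1B_n(x)\,dx=0$ for $n\ge1$; $B_k=B_k(0)$ and $S_k(x)=B_k(x)-B_k$. Generalized Taylor polynomial. For $\boldsymbol{x}\in\mathbb{R}^2$, $$\begin{aligned}P_{m}^{[\Delta_2(V_1,V_2,V_3);V_1]}[f](\boldsymbol{x})=&f(V_1)+\sum_{j=1}^{m}\left(D_1^{(0,j-1)}f(V_3)-D_1^{(0,j-1)}f(V_1)\right)\frac{S_j(\lambda_2+\lambda_3)}{j!}\\&+\sum_{i=1}^{m}\sum_{j=1}^{m-i+1}\Big((-1)^{i+j}\big(D_2^{(j-1,i-1)}f(V_2)-D_2^{(j-1,i-1)}f(V_1)\big)\\&\quad+(-1)^j\big(D_3^{(j-1,i-1)}f(V_3)-D_3^{(j-1,i-1)}f(V_1)\big)\Big)\frac{(\lambda_2+\lambda_3)^{i-1}S_i\left(\frac{\lambda_2}{\lambda_2+\lambda_3}\right)}{i!}\frac{S_j(\lambda_2+\lambda_3)}{j!},\end{aligned}$$ where $\lambda_k=\lambda_k(\boldsymbol{x})$. The products $(\lambda_2+\lambda_3)^{i-1}S_i\left(\frac{\lambda_2}{\lambda_2+\lambda_3}\right)S_j(\lambda_2+\lambda_3)$ are polynomials in $\lambda_2,\lambda_3$ and are understood as such also where $\lambda_2+\lambda_3=0$. Taylor polynomial: $T_m[f,V_1](\boldsymbol{x})=\sum_{|\alpha|\le m}\frac{1}{\alpha!}\frac{\partial^{|\alpha|}f}{\partial x^{\alpha_1}\partial y^{\alpha_2}}(V_1)(x-x_1)^{\alpha_1}(y-y_1)^{\alpha_2}$.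 The derivatives of order $m+1$ under the integrals have $D_{21}$ (resp. $D_{31}$) as outermost derivative along the segment of integration; they are the derivatives in $t$ of the Lipschitz functions obtained by restricting the corresponding $m$-th order directional derivatives to that segment, and so are defined for almost every $t\in[0,1]$. *)

(* Defs.v *)
From HB Require Import structures.
From mathcomp Require Import all_boot all_order all_algebra.
From mathcomp Require Import all_classical all_reals all_analysis.
From mathcomp Require Import ring.

Set Implicit Arguments.
Unset Strict Implicit.
Unset Printing Implicit Defensive.

Import Order.TTheory GRing.Theory Num.Theory.
Import numFieldNormedType.Exports.

Local Open Scope classical_set_scope.
Local Open Scope ring_scope.

Section Bernoulli.
Variable R : realType.
Implicit Types p : {poly R}.

(* The antiderivative of p vanishing at 0. *)
Definition primitive p : {poly R} :=
  \poly_(i < (size p).+1) (p`_i.-1 *+ (i != 0)%N / i%:R).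

(* B_n is the antiderivative of n B_(n-1) whose integral over [0, 1] is 0; see
   bernoulli0, deriv_bernoulli and Rintegral_bernoulli. *)
Fixpoint bernoulli (n : nat) : {poly R} :=
  if n is n'.+1 then
    let q := primitive (n%:R *: bernoulli n') in
    q - (primitive q).[1]%:P
  else 1.

Definition bernS (k : nat) : {poly R} := bernoulli k - ((bernoulli k).[0])%:P.

Lemma coef_primitive p i : (primitive p)`_i = p`_i.-1 *+ (i != 0)%N / i%:R.
Proof.
rewrite coef_poly ltnS; case: ltnP => //; case: i => [|i /= pi]; first by [].
by rewrite nth_default// mul0rn mul0r.
Qed.

Lemma deriv_primitive p : (primitive p)^`() = p.
Proof.
apply/polyP => i; rewrite coef_deriv coef_primitive /= mulr1n.
by rewrite -[LHS]mulr_natr divfK ?pnatr_eq0//.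
Qed.

Lemma horner_primitive0 p : (primitive p).[0] = 0.
Proof. by rewrite horner_coef0 coef_primitive mulr0n mul0r. Qed.

Lemma size_primitive p n : (size p <= n)%N -> (size (primitive p) <= n.+1)%N.
Proof. by move=> pn; apply: leq_trans (size_poly _ _) _; rewrite ltnS. Qed.

Lemma Rintegral_poly p :
  \int[lebesgue_measure]_(x in `[0%R, 1%R]) p.[x] = (primitive p).[1].
Proof.
rewrite /Rintegral (@continuous_FTC2 _ (horner p) (horner (primitive p))) //=.
- by rewrite horner_primitive0 subr0.
- by apply: continuous_subspaceT => x; exact: continuous_horner.
- split; first by move=> x _; exact: derivable_horner.
  + by apply: cvg_at_right_filter; exact: continuous_horner.
  + by apply: cvg_at_left_filter; exact: continuous_horner.
- by move=> x _; rewrite -derivE deriv_primitive.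
Qed.

Lemma bernoulli0 : bernoulli 0 = 1.
Proof. by []. Qed.

Lemma deriv_bernoulli n : (bernoulli n.+1)^`() = n.+1%:R *: bernoulli n.
Proof. by rewrite /= derivB derivC subr0 deriv_primitive. Qed.

Lemma Rintegral_bernoulli n :
  \int[lebesgue_measure]_(x in `[0%R, 1%R]) (bernoulli n.+1).[x] = 0.
Proof.
rewrite Rintegral_poly /=; set q := primitive (_ *: _); set c := (primitive q).[1].
suff -> : primitive (q - c%:P) = primitive q - c *: 'X.
  by rewrite hornerD hornerN hornerZ hornerX mulr1 subrr.
move: q @c => q c; apply/polyP => i; rewrite coefB coefZ coefX !coef_primitive coefB coefC.
case: i => [|[|i]] /=; first by rewrite !mulr0n !mul0r mulr0 subr0.
  by rewrite !mulr1n mulr1 !divr1.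
by rewrite !mulr1n mulr0 !subr0.
Qed.

Lemma size_bernoulli n : (size (bernoulli n) <= n.+1)%N.
Proof.
elim: n => [|n ih]; first by rewrite size_poly1.
rewrite /= (leq_trans (size_polyD _ _))// geq_max; apply/andP; split.
  by apply: size_primitive; rewrite (leq_trans (size_scale_leq _ _)).
by rewrite size_polyN (leq_trans (size_polyC_leq1 _)).
Qed.

(* The polynomial in (l, s) equal to s^(i-1) S_i(l/s) S_j(s), written as
   (s^i S_i(l/s)) (S_j(s)/s) with both factors expanded. *)
Definition bernSS (i j : nat) (l s : R) : R :=
  (\sum_(k < i.+1) (bernS i)`_k * l ^+ k * s ^+ (i - k)) *
  (bernS j %/ 'X).[s].

Lemma bernSSE i j l s : (0 < i)%N -> s != 0 ->
  bernSS i j l s = s ^+ i.-1 * (bernS i).[l / s] * (bernS j).[s].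
Proof.
move=> i0 s0.
have jE : (bernS j).[s] = (bernS j %/ 'X).[s] * s.
  have /divpK {1}<- : 'X %| bernS j.
    by rewrite -['X]subr0 dvdp_XsubCl rootE hornerD hornerN hornerC subrr.
  by rewrite hornerM hornerX.
have iE : (bernS i).[l / s] * s ^+ i =
    \sum_(k < i.+1) (bernS i)`_k * l ^+ k * s ^+ (i - k).
  rewrite (@horner_coef_wide _ i.+1); last first.
    rewrite (leq_trans (size_polyD _ _))// geq_max size_bernoulli/=.
    by rewrite size_polyN (leq_trans (size_polyC_leq1 _)).
  rewrite mulr_suml; apply: eq_bigr => k _.
  have ki : (k <= i)%N by rewrite -ltnS.
  rewrite -[in s ^+ i](subnK ki) exprD expr_div_n.
  by field; rewrite expf_neq0.
by rewrite /bernSS -iE jE -[in s ^+ i](prednK i0) exprS; ring.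
Qed.

End Bernoulli.

Section Smooth.
Variable R : realType.
Implicit Types (F G : R * R -> R) (D : set (R * R)) (v : R * R).

Definition d1 F : R * R -> R := fun x => derive F x (1, 0).
Definition d2 F : R * R -> R := fun x => derive F x (0, 1).

Fixpoint Cn (n : nat) F : Prop :=
  if n is n'.+1 then
    [/\ forall x, differentiable F x, Cn n' (d1 F) & Cn n' (d2 F)]
  else continuous F.

Definition partial (a b : nat) F : R * R -> R := iter a d1 (iter b d2 F).

(* v . grad F *)
Definition dird v F : R * R -> R := fun x => v.1 * d1 F x + v.2 * d2 F x.

Definition is_ext (m : nat) D (f : R * R -> R) : set (R * R -> R) :=
  [set F | Cn m F /\ forall x, D x -> F x = f x].

(* Functions on D are represented by functions on the plane whose values
   outside D are irrelevant. *)
Definition Cn_on (m : nat) D (f : R * R -> R) : Prop := is_ext m D f !=set0.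

(* A C^m extension of f; the derivatives of f on D are those of [ext m D f],
   and up to order m they do not depend on the extension: see
   dird_foldr_ext and partial_ext. *)
Definition ext (m : nat) D (f : R * R -> R) : R * R -> R :=
  xget f (is_ext m D f).

Definition Cn1_on (m : nat) D (f : R * R -> R) : Prop :=
  Cn_on m D f /\
  forall j, (j <= m)%N ->
    [lipschitz partial (m - j) j (ext m D f) x | x in D].

Lemma Cn_cont n F : Cn n F -> continuous F.
Proof.
case: n => //= n [dF _ _] x; exact: differentiable_continuous.
Qed.

Lemma Cn_C1 n F : Cn n.+1 F -> Cn 1 F.
Proof. by move=> [dF F1 F2]; split => //; [apply: Cn_cont F1|apply: Cn_cont F2]. Qed.

Lemma dlin a b F G x v : differentiable F x -> differentiable G x ->
  derive (fun y => a * F y + b * G y) x v = a * derive F x v + b * derive G x v.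
Proof.
move=> dF dG.
have dF' := diff_derivable (v := v) dF; have dG' := diff_derivable (v := v) dG.
rewrite (_ : (fun y => _) = (a *: F) + (b *: G)); last by apply/funext.
by rewrite deriveD; [rewrite !deriveZ|exact: derivableZ..].
Qed.

Lemma Cn_lin n a b F G : Cn n F -> Cn n G ->
  Cn n (fun y => a * F y + b * G y).
Proof.
elim: n F G => /= [F G cF cG x|n ih F G [dF F1 F2] [dG G1 G2]].
  by apply: cvgD; apply: cvgM; [exact: cvg_cst|exact: cF|exact: cvg_cst|exact: cG].
split.
- move=> x; rewrite (_ : (fun y => _) = (a *: F) + (b *: G)); last exact/funext.
  by apply: differentiableD; exact: differentiableZ.
- rewrite (_ : d1 _ = fun y => a * d1 F y + b * d1 G y); first exact: ih.
  by apply/funext => x; rewrite /d1 dlin.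
- rewrite (_ : d2 _ = fun y => a * d2 F y + b * d2 G y); first exact: ih.
  by apply/funext => x; rewrite /d2 dlin.
Qed.

Lemma Cn_dird n v F : Cn n.+1 F -> Cn n (dird v F).
Proof. by move=> [_ F1 F2]; exact: Cn_lin. Qed.

Lemma dird_eq D F G v : convex_set (D : set (convex_lmodType (R * R)%type)) ->
  D° !=set0 -> Cn 1 F -> Cn 1 G -> (forall x, D x -> F x = G x) ->
  forall x, D x -> dird v F x = dird v G x.
Proof.
move=> cD [p /nbhs_ballP[r /= r0 prD]] cF cG FG.
have near_eq x : D° x -> dird v F x = dird v G x.
  move=> /nbhs_interior/nbhs_singleton Dx.
  have xFG : \near x, F x = G x by apply: filterS Dx => y; exact: FG.
  by rewrite /dird /d1 /d2 !(near_eq_derive _ xFG).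
have cd : continuous (fun y => dird v F y - dird v G y).
  by move=> y; apply: cvgB; apply: (Cn_cont (n := 0)); exact: Cn_dird.
move=> x Dx; apply/subr0_eq.
pose g (t : R) := x + t *: (p - x).
have cg : g t @[t --> 0^'+] --> x.
  apply: cvg_at_right_filter; rewrite -[X in _ --> X]addr0 -[X in _ + X](scale0r (p - x)).
  by apply: cvgD; [exact: cvg_cst|apply: cvgZ; [exact: cvg_id|exact: cvg_cst]].
have lim1 : (dird v F (g t) - dird v G (g t)) @[t --> 0^'+] -->
    dird v F x - dird v G x.
  exact: (cvg_comp g (fun y => dird v F y - dird v G y) cg (cd x)).
have lim0 : (dird v F (g t) - dird v G (g t)) @[t --> 0^'+] --> (0 : R).
  apply: cvg_near_cst.
  near=> t.
  have t0 : 0 < t by near: t; exact: nbhs_right_gt.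
  have t1 : t <= 1 by near: t; exact: nbhs_right_le.
  apply/eqP; rewrite subr_eq0; apply/eqP/near_eq.
  apply/nbhs_ballP; exists (t * r) => /=; first exact: mulr_gt0.
  move=> y; rewrite -ball_normE /= => gy.
  pose z := p + t^-1 *: (y - g t).
  have Dz : D z.
    apply: prD; rewrite -ball_normE /= /z opprD addrA subrr add0r normrN normrZ.
    rewrite gtr0_norm ?invr_gt0// mulrC ltr_pdivrMr// mulrC -normrN opprB.
    exact: gy.
  have t01 : (0 <= t <= 1)%R by rewrite ltW.
  have := cD z x (Itv01 (ltW t0) t1).
  rewrite !inE => /(_ Dz Dx).
  congr D; rewrite /conv /= /z /g; case: (x) => x1 x2; case: (p) => p1 p2.
  by case: (y) => y1 y2; rewrite /unstable.onem; congr pair => /=; rewrite /GRing.scale /=; field; rewrite gt_eqF.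
exact: (cvg_unique _ lim1 lim0).
Unshelve. all: by end_near. Qed.

Lemma dird_foldr_eq D F G m (vs : seq (R * R)) :
  convex_set (D : set (convex_lmodType (R * R)%type)) -> D° !=set0 ->
  Cn m F -> Cn m G -> (forall x, D x -> F x = G x) -> (size vs <= m)%N ->
  forall x, D x -> foldr dird F vs x = foldr dird G vs x.
Proof.
move=> cD iD; rewrite -(revK vs) size_rev -!foldl_rev revK.
elim: (rev vs) m F G => //= v {}vs ih [//|m] F G cF cG FG vm.
apply: (ih m) => //; [exact: Cn_dird..|].
by apply: dird_eq => //; [exact: Cn_C1 cF|exact: Cn_C1 cG].
Qed.

Lemma dird1 F : dird (1, 0) F = d1 F.
Proof. by apply/funext => x; rewrite /dird mul1r mul0r addr0. Qed.

Lemma dird2 F : dird (0, 1) F = d2 F.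
Proof. by apply/funext => x; rewrite /dird mul1r mul0r add0r. Qed.

Lemma dird_foldr_ext D (f : R * R -> R) F m (vs : seq (R * R)) :
  convex_set (D : set (convex_lmodType (R * R)%type)) -> D° !=set0 ->
  is_ext m D f F -> (size vs <= m)%N ->
  forall x, D x -> foldr dird (ext m D f) vs x = foldr dird F vs x.
Proof.
move=> cD iD extF; have [cE Ef] := xgetI f extF; case: (extF) => cF Ff.
by apply: dird_foldr_eq => // x Dx; rewrite /ext Ef// Ff.
Qed.

Lemma partial_ext D (f : R * R -> R) F m a b :
  convex_set (D : set (convex_lmodType (R * R)%type)) -> D° !=set0 ->
  is_ext m D f F -> (a + b <= m)%N ->
  forall x, D x -> partial a b (ext m D f) x = partial a b F x.
Proof.
move=> cD iD extF abm.
have pE G : partial a b G = foldr dird G (nseq a (1, 0) ++ nseq b (0, 1)).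
  have nE n w H : foldr dird H (nseq n w) = iter n (dird w) H.
    by elim: n => //= n ->.
  rewrite foldr_cat !nE /partial.
  by rewrite (eq_iter dird1) (eq_iter dird2).
by rewrite !pE; apply: dird_foldr_ext; rewrite ?size_cat ?size_nseq.
Qed.

End Smooth.

Section Triangle.
Variable R : realType.
Implicit Types (P Q V x : R * R) (F G f : R * R -> R) (D : set (R * R)).

Definition det3 P Q V : R :=
  \det (\matrix_(r < 3, c < 3)
    let W := tnth [tuple P; Q; V] c in tnth [tuple 1; W.1; W.2] r).

Lemma det3E P Q V :
  det3 P Q V = (Q.1 - P.1) * (V.2 - P.2) - (V.1 - P.1) * (Q.2 - P.2).
Proof.
rewrite /det3 (expand_det_row _ ord0) !big_ord_recl big_ord0 /cofactor.
rewrite !(expand_det_row _ (ord0 : 'I_2)) !big_ord_recl !big_ord0 /cofactor.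
rewrite !det_mx11 !mxE /=.
rewrite !(tnth_nth V) !(tnth_nth (0 : R)) /= /bump /=.
by ring.
Qed.

Variables (V1 V2 V3 : R * R).

Definition lam1 x : R := det3 x V2 V3 / det3 V1 V2 V3.
Definition lam2 x : R := det3 V1 x V3 / det3 V1 V2 V3.
Definition lam3 x : R := det3 V1 V2 x / det3 V1 V2 V3.

Definition D1 (b1 b2 : nat) F :=
  iter b1 (dird (V2 - V1)) (iter b2 (dird (V3 - V1)) F).
Definition D2 (b1 b2 : nat) F :=
  iter b1 (dird (V1 - V2)) (iter b2 (dird (V3 - V2)) F).
Definition D3 (b1 b2 : nat) F :=
  iter b1 (dird (V1 - V3)) (iter b2 (dird (V2 - V3)) F).

Definition genTaylor (m : nat) D f x : R :=
  let F := ext m D f in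
  let l2 := lam2 x in
  let s := lam2 x + lam3 x in
  f V1
  + \sum_(1 <= j < m.+1)
      (D1 0 j.-1 F V3 - D1 0 j.-1 F V1) * ((bernS _ j).[s] / j`!%:R)
  + \sum_(1 <= i < m.+1) \sum_(1 <= j < (m - i + 1).+1)
      ((-1) ^+ (i + j) * (D2 j.-1 i.-1 F V2 - D2 j.-1 i.-1 F V1)
       + (-1) ^+ j * (D3 j.-1 i.-1 F V3 - D3 j.-1 i.-1 F V1))
      * (bernSS i j l2 s / (i`!%:R * j`!%:R)).

Definition taylor (m : nat) D f x : R :=
  \sum_(a < m.+1) \sum_(b < m.+1 | (a + b <= m)%N)
    partial a b (ext m D f) V1 / (a`!%:R * b`!%:R)
    * (x.1 - V1.1) ^+ a * (x.2 - V1.2) ^+ b.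

(* \int_0^1 (D_{V - V1}^(k + 1) G)(V1 + t (V - V1)) (1 - t)^k / k! dt, where the
   outermost derivative is the derivative in t along the segment from V1 to V.
   For 0 < t < 1 that derivative depends only on G on the segment. The set of t
   where it does not exist is negligible; [derive1] is a junk value there. *)
Definition remainder (k : nat) G V : R :=
  \int[lebesgue_measure]_(t in `[0%R, 1%R])
    (derive1 (fun u : R => iter k (dird (V - V1)) G (V1 + u *: (V - V1))) t
     * (1 - t) ^+ k / k`!%:R).

(* In the double sum i + j <= m + 1, so m + 2 - i - j is a true subtraction. *)
Definition delta (m : nat) D f x : R :=
  let F := ext m D f in
  let l2 := lam2 x in
  let s := lam2 x + lam3 x in
  \sum_(1 <= j < m.+1)
    remainder (m - j + 1) (D1 0 j.-1 F) V3 * ((bernS _ j).[s] / j`!%:R)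
  + \sum_(1 <= i < m.+1) \sum_(1 <= j < (m - i + 1).+1)
      ((-1) ^+ (i + j) * remainder (m + 2 - i - j) (D2 j.-1 i.-1 F) V2
       + (-1) ^+ j * remainder (m + 2 - i - j) (D3 j.-1 i.-1 F) V3)
      * (bernSS i j l2 s / (i`!%:R * j`!%:R)).

End Triangle.

(* Main.v *)
Require Import Defs.
From HB Require Import structures.
From mathcomp Require Import all_boot all_order all_algebra.
From mathcomp Require Import all_classical all_reals all_analysis.
From mathcomp Require Import measurable_realfun ring lra zify.

Set Implicit Arguments.
Unset Strict Implicit.
Unset Printing Implicit Defensive.

Import Order.TTheory GRing.Theory Num.Theory.
Import numFieldNormedType.Exports.

Local Open Scope classical_set_scope.
Local Open Scope ring_scope.

(** Write U and W for the derivations D_21 and D_31 applied at V1. Constant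
coefficient derivations commute on C^m functions, so each iterated directional
derivative at V1 is the value of a linear functional on a product of the linear
forms U, W, U - W and their opposites, and the Taylor polynomial is the value of
the same functional on the truncation of exp (l2 U + l3 W), because
x - V1 = l2 (V2 - V1) + l3 (V3 - V1).

Each difference G V - G V1 in the generalized Taylor polynomial is expanded by
the one-variable Taylor formula along the segment from V1 to V. The integral
remainders add up to the error term [delta], and what is left is a statement
about exponentials of formal variables: with s = l2 + l3, the generating function
   sum_(j >= 1) S_j(y) z^j / j! = z (exp (y z) - 1) / (exp z - 1)
turns the two sums of the generalized Taylor polynomial into
   exp (s W) - 1   and   exp (s W) (exp (l2 (U - W)) - 1),
whose sum is exp (l2 U + l3 W) - 1. Reading this off degree by degree is
[bernoulli_exp_identity]; every term of degree at most m is present and no other.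

The analytic difficulty is the last step of the one-variable formula: the
derivative of order m is only Lipschitz along the segment. The fundamental
theorem of calculus for a Lipschitz function g ([lip01_FTC]) comes from the
Stieltjes measures of x/2 + g and x/2 - g (after scaling): they add up to the
Lebesgue measure, hence have densities, and Lebesgue differentiation identifies
the density with the derivative almost everywhere. As the derivative takes
uncontrolled values on the exceptional null set, the integral of the remainder is
compared with that of the density by [ae_eq_integral_nonmeasurable], which asks
for no measurability. *)

(** * Integrals of almost everywhere equal functions *)

Section NonMeasurable.
Import HBNNSimple.

(** A simple function below u becomes one below v, with the same integral, once
it is set to 0 on the null set N. *)
Lemma le_sup_sintegral_ae d (T : measurableType d) (R : realType)
    (mu : {measure set T -> \bar R}) (N : set T) (u v : T -> \bar R) :
  measurable N -> mu N = 0%E -> (forall x, 0 <= v x)%E ->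
  (forall x, ~ N x -> u x = v x) ->
  (ereal_sup [set sintegral mu h |
      h in [set h : {nnsfun T >-> R} | forall x, (h x)%:E <= u x]] <=
   ereal_sup [set sintegral mu h |
      h in [set h : {nnsfun T >-> R} | forall x, (h x)%:E <= v x]])%E.
Proof.
move=> mN N0 v0 uv; apply: ge_ereal_sup => _ /= [h hu <-].
have mC : measurable (~` N) by exact: measurableC.
apply: ereal_sup_ubound; exists (proj_nnsfun h mC) => [x /=|].
  rewrite mindicE; have [xN|xN] := boolP (x \in ~` N).
    by rewrite mulr1 -uv//; move: xN; rewrite inE.
  by rewrite mulr0.
have hT : (\int[mu]_x (h x)%:E = sintegral mu h)%E.
  by rewrite integral_nnsfun// patch_setT.
rewrite -hT (ge0_negligible_integral mN)//=; last 2 first.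
- by apply/measurable_EFinP.
- by move=> x _; rewrite lee_fin.
by rewrite setTD integral_nnsfun// mrestrict.
Qed.

(** The integral of an arbitrary nonnegative function is a supremum over the
simple functions below it, and this supremum does not see null sets. *)
Lemma ae_eq_integral_nonmeasurable d (T : measurableType d) (R : realType)
    (mu : {measure set T -> \bar R}) (D : set T) (f g : T -> \bar R) :
  {ae mu, forall x, D x -> f x = g x} ->
  (\int[mu]_(x in D) f x = \int[mu]_(x in D) g x)%E.
Proof.
move=> [N [mN N0 fgN]].
have fg x : ~ N x -> (f \_ D) x = (g \_ D) x.
  move=> Nx; rewrite !patchE; case: ifPn => // xD.
  by apply: contrapT => fgx; apply/Nx/fgN => /= /(_ (set_mem xD)).
rewrite /integral; congr (_ - _)%E; apply/eqP; rewrite eq_le; apply/andP; split;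
  apply: (le_sup_sintegral_ae mN N0) => //= x Nx.
- by rewrite !funeposE fg.
- by rewrite !funeposE fg.
- by rewrite !funenegE fg.
- by rewrite !funenegE fg.
Qed.

End NonMeasurable.

(** * The fundamental theorem of calculus for Lipschitz functions *)

Section LipschitzFTC.
Variable R : realType.
Local Notation mu := (@lebesgue_measure R).

Let lsm_oc (c : cumulative R R) (a b : R) : a <= b ->
  lebesgue_stieltjes_measure c `]a, b]%classic = (c b - c a)%:E.
Proof.
move=> ab; rewrite /lebesgue_stieltjes_measure/= /measure_extension/=.
by rewrite measurable_mu_extE/=; [rewrite wlength_itv_bnd|exact: is_ocitv].
Qed.

Let half_lip_mono (g : R -> R) :
  (forall x y, `|g x - g y| <= 2^-1 * `|x - y|) ->
  nondecreasing (fun x : R => 2^-1 * x + g x).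
Proof.
move=> gL x y xy; have := gL x y.
by rewrite ler_norml (distrC x) (ger0_norm (_ : 0 <= y - x)) ?subr_ge0// => /andP[]; lra.
Qed.

Let half_lip_cont (g : R -> R) :
  (forall x y, `|g x - g y| <= 2^-1 * `|x - y|) ->
  continuous (fun x : R => 2^-1 * x + g x).
Proof.
move=> gL x; apply/cvgrPdist_le => e e0; near=> y.
rewrite opprD addrACA -mulrBr.
apply: (le_trans (ler_normD _ _)); rewrite normrM (ger0_norm (_ : 0 <= 2^-1))//.
have := gL x y; have : `|x - y| <= e by near: y; exact: cvgr_dist_le.
by lra.
Unshelve. all: by end_near. Qed.

Let half_lip_oppr (g : R -> R) :
  (forall x y, `|g x - g y| <= 2^-1 * `|x - y|) ->
  forall x y, `|(- g x) - (- g y)| <= 2^-1 * `|x - y|.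
Proof. by move=> gL x y; rewrite -opprD normrN. Qed.

(** With constant 1/2 both p = x/2 + g and q = x/2 - g are nondecreasing and
p + q = x, so the Stieltjes measure of p is dominated by the Lebesgue measure:
its Radon-Nikodym density minus 1/2 is the derivative of g. *)
Lemma half_lipschitz_FTC (g : R -> R) :
  (forall x y, `|g x - g y| <= 2^-1 * `|x - y|) ->
  exists h : R -> R, [/\ mu.-integrable `[0, 1] (EFin \o h),
    \int[mu]_(t in `[0, 1]) h t = g 1 - g 0 &
    {ae mu, forall t, 0 < t < 1 -> derivable g t 1 /\ derive1 g t = h t}].
Proof.
move=> gL.
pose p x := 2^-1 * x + g x; pose q x := 2^-1 * x - g x.
have pnd : nondecreasing p by exact: half_lip_mono.
have prc : right_continuous p by exact/right_continuousW/half_lip_cont.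
have qnd : nondecreasing q by exact/half_lip_mono/half_lip_oppr.
have qrc : right_continuous q.
  exact/right_continuousW/(half_lip_cont (half_lip_oppr gL)).
pose P : cumulative R R := HB.pack p (isCumulative.Build R _ R p pnd prc).
pose Q : cumulative R R := HB.pack q (isCumulative.Build R _ R q qnd qrc).
have PQ A : measurable A -> mu A =
    (lebesgue_stieltjes_measure P A + lebesgue_stieltjes_measure Q A)%E.
  move=> mA; rewrite -measure_addE; apply: lebesgue_measure_unique => // X.
  move=> /ocitvP[->|[[a b]/= ab ->]]; first by rewrite !measure0.
  rewrite [RHS]measure_addE.
  rewrite [LHS](lsm_oc idfun) ?ltW//=.
  have := lsm_oc P (ltW ab); have := lsm_oc Q (ltW ab); move=> /= -> ->.
  rewrite -EFinD; congr (_%:E).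
  by rewrite /p /q; lra.
have m01 : measurable (`]0, 1]%classic : set (measurableTypeR R)).
  exact: measurable_itv.
have fin01 : (lebesgue_stieltjes_measure P `]0%R, 1%R]%classic < +oo)%E.
  by rewrite lsm_oc// ltry.
(* restricting to ]0, 1] makes the measure finite *)
pose nu := mfrestr m01 fin01.
have nu_mu : nu `<< mu.
  apply/null_content_dominatesP => A mA muA0; have /esym/eqP := PQ _ mA; rewrite [X in _ == X]muA0.
  rewrite padde_eq0; [|exact: measure_ge0..].
  move=> /andP[/eqP A0 _]; apply: (subset_measure0 _ mA _ A0) => //.
  exact: measurableI.
have [h0 [h00 h0fin h0int h0E]] := radon_nikodym_sigma_finite nu_mu.
pose h (x : R) : R := fine (h0 x).
have hE : h0 = EFin \o h by apply/funext => x; rewrite /h /= fineK.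
rewrite hE in h0int h0E.
have FE y : 0 <= y <= 1 -> \int[mu]_(t in `]0, y]) h t = p y - p 0.
  move=> /andP[y0 y1]; have my := @measurable_itv R `]0, y].
  rewrite /Rintegral -(h0E _ my).
  rewrite /nu /= /mfrestr /mrestr.
  rewrite (_ : _ `&` _ = `]0, y]%classic) ?lsm_oc//.
  apply/seteqP; split => t /=; rewrite !in_itv/=; first by case.
  by move=> /andP[-> ty]; rewrite ty (le_trans ty).
have h_loc : locally_integrable [set: R] h.
  by have := integrable_locally measurableT h0int; rewrite patch_setT.
have h_int y : mu.-integrable [set` Interval (BRight 0) (BRight y)] (EFin \o h).
  by apply: integrableS h0int => //; exact: measurable_itv.
have c_int : mu.-integrable `[0, 1] (EFin \o (fun=> 2^-1 : R)).
  apply: continuous_compact_integrable; first exact: segment_compact.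
  exact: cst_continuous.
have m11 : measurable (`[0, 1]%classic : set (measurableTypeR R)).
  exact: measurable_itv.
have h01 : mu.-integrable `[0, 1] (EFin \o h).
  by apply: integrableS h0int => //; exact: measurable_itv.
exists (fun t => h t - 2^-1); split.
- rewrite (_ : EFin \o _ = ((EFin \o h) \- (EFin \o (fun=> (2^-1)%R : R)))%E)//.
  exact: (integrableB m11 h01 c_int).
- rewrite (RintegralB m11 h01 c_int) (Rintegral_cst _ m11)/=.
  rewrite lebesgue_measure_itv/= lte_fin ltr01.
  rewrite -Rintegral_itv_obnd_cbnd; last exact: h_int.
  by rewrite FE ?lexx ?ler01// /p sube0/=; lra.
- have := FTC1 h_int h_loc.
  apply: filterS; first exact: (ae_filter_ringOfSetsType mu).
  move=> t /= Ft /andP[t0 t1].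
  have [|dF F't] := Ft; first by rewrite lte_fin.
  set F := (fun x : R => _) in dF F't.
  pose G y := F y + (- 2^-1 *: y + p 0).
  have FG : \forall y \near t, G y = g y.
    near=> y; rewrite /G /F FE; first by rewrite /p/= /GRing.scale/=; lra.
    apply/andP; split; apply/ltW; near: y; [exact: lt_nbhsr|exact: lt_nbhsl].
  have dl : is_derive t (1 : R) (fun y : R => - 2^-1 *: y + p 0) (- 2^-1).
    by apply: is_derive_eq; rewrite addr0 /GRing.scale/= mulr1.
  have dF1 : is_derive t (1 : R) F (h t).
    by split; [exact: dF|rewrite -derive1E; exact: F't].
  have dG : is_derive t (1 : R) G (h t - 2^-1) := is_deriveD dF1 dl.
  have [dG1 dG2] := dG; split; first exact: near_eq_derivable dG1.
  by rewrite derive1E -(near_eq_derive _ FG).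
Unshelve. all: by end_near. Qed.

Definition lip01 (g : R -> R) := exists K : R, forall x y : R,
  0 <= x <= 1 -> 0 <= y <= 1 -> `|g x - g y| <= K * `|x - y|.

Let clamp (t : R) := Num.max 0 (Num.min 1 t).

Let clamp01 t : 0 <= clamp t <= 1.
Proof. by rewrite /clamp le_max lexx ge_max ler01 ge_min lexx. Qed.

Let clamp_id t : 0 <= t <= 1 -> clamp t = t.
Proof. by move=> /andP[t0 t1]; rewrite /clamp min_r// max_r. Qed.

Let clamp_lip x y : `|clamp x - clamp y| <= `|x - y|.
Proof.
wlog xy : x y / x <= y => [H|].
  by have [|/ltW] := leP x y => /H//; rewrite distrC (distrC y).
rewrite distrC (distrC x) (ger0_norm (_ : 0 <= y - x)) ?subr_ge0//.
rewrite /clamp ler_norml !maxEle !minEle.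
by case: (leP 1 x) => ?; case: (leP 1 y) => ?; rewrite ?ler01; case: (leP 0 x) => ?;
  case: (leP 0 y) => ?; apply/andP; split; lra.
Qed.

(** Reduction to constant 1/2: extend g by constants outside [0, 1] and divide
it by L = 2 (|K| + 1), which is positive whatever the sign of K. *)
Lemma lip01_FTC (g : R -> R) : lip01 g ->
  exists h : R -> R, [/\ mu.-integrable `[0, 1] (EFin \o h),
    \int[mu]_(t in `[0, 1]) h t = g 1 - g 0 &
    {ae mu, forall t, 0 < t < 1 -> derivable g t 1 /\ derive1 g t = h t}].
Proof.
move=> [K gK]; pose L := 2 * (`|K| + 1).
have L0 : 0 < L by rewrite /L mulr_gt0// ltr_wpDl.
pose g' x := L^-1 * g (clamp x).
have g'L x y : `|g' x - g' y| <= 2^-1 * `|x - y|.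
  rewrite /g' -mulrBr normrM gtr0_norm ?invr_gt0// ler_pdivrMl//.
  apply: (le_trans (gK _ _ (clamp01 x) (clamp01 y))).
  apply: (@le_trans _ _ (`|K| * `|x - y|)).
    apply: (@le_trans _ _ (`|K| * `|clamp x - clamp y|)).
      by apply: ler_wpM2r => //; exact: ler_norm.
    by rewrite ler_wpM2l // clamp_lip.
  rewrite /L mulrA; apply: ler_wpM2r => //; have := normr_ge0 K; lra.
have [h [h_int hE h_ae]] := half_lipschitz_FTC g'L.
have m11 : measurable (`[0, 1]%classic : set (measurableTypeR R)).
  exact: measurable_itv.
exists (fun t => L * h t); split.
- rewrite (_ : EFin \o _ = (fun x => L%:E * (EFin \o h) x)%E)//.
  exact: integrableZl.
- rewrite RintegralZl// hE /g' !clamp_id ?lexx ?ler01//.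
  by rewrite -mulrBr mulVKf ?gt_eqF.
- apply: filterS h_ae; first exact: (ae_filter_ringOfSetsType mu).
  move=> t /= Ft t01; have [dg' g'E] := Ft t01.
  have /andP[t0 t1] := t01.
  have gg' : \forall y \near t, (L *: (g' : R -> R)) y = g y.
    near=> y; rewrite [LHS](_ : _ = L * g' y)// /g' clamp_id.
      by rewrite mulVKf ?gt_eqF.
    apply/andP; split; apply/ltW; near: y; [exact: lt_nbhsr|exact: lt_nbhsl].
  have dLg' : derivable (L *: (g' : R -> R)) t 1 by apply: derivableZ.
  split; first exact: near_eq_derivable dLg'.
  by rewrite derive1E -(near_eq_derive _ gg') deriveZ//= -derive1E g'E.
Unshelve. all: by end_near. Qed.

Lemma lip01D g1 g2 : lip01 g1 -> lip01 g2 -> lip01 (fun t => g1 t + g2 t).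
Proof.
move=> [K1 H1] [K2 H2]; exists (K1 + K2) => x y x01 y01.
rewrite opprD addrACA mulrDl; apply: (le_trans (ler_normD _ _)).
by apply: lerD; [exact: H1|exact: H2].
Qed.

Lemma lip01_bounded g : lip01 g -> exists M : R, forall x, 0 <= x <= 1 -> `|g x| <= M.
Proof.
move=> [K gK]; exists (`|g 0| + `|K|) => x x01.
have /gK/(_ x01) : 0 <= (0 : R) <= 1 by rewrite lexx ler01.
rewrite sub0r normrN distrC => H.
rewrite -(subrK (g 0) (g x)) addrC; apply: (le_trans (ler_normD _ _)).
rewrite lerD2l; apply: (le_trans H); apply: (@le_trans _ _ (`|K| * `|x|)).
  by rewrite ler_wpM2r// ler_norm.
by rewrite ler_piMr// ger0_norm; move: x01; lra.
Qed.

Lemma lip01M g1 g2 : lip01 g1 -> lip01 g2 -> lip01 (fun t => g1 t * g2 t).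
Proof.
move=> L1 L2; have [M1 B1] := lip01_bounded L1; have [M2 B2] := lip01_bounded L2.
move: L1 L2 => [K1 H1] [K2 H2]; exists (M1 * K2 + K1 * M2) => x y x01 y01.
have -> : g1 x * g2 x - g1 y * g2 y = g1 x * (g2 x - g2 y) + (g1 x - g1 y) * g2 y.
  by ring.
rewrite [leRHS]mulrDl; apply: (le_trans (ler_normD _ _)); rewrite !normrM.
apply: lerD.
  by rewrite -mulrA ler_pM// ?B1 ?H2.
by rewrite mulrAC ler_pM// ?B2 ?H1.
Qed.

Lemma lip01_cst (c : R) : lip01 (fun=> c).
Proof. by exists 0 => x y _ _; rewrite /= subrr normr0 mul0r. Qed.

Lemma lip01_onem : lip01 (fun t => 1 - t).
Proof.
exists 1 => x y _ _; rewrite mul1r.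
have -> : 1 - x - (1 - y) = - (x - y) by ring.
by rewrite normrN.
Qed.

Lemma lip01X g n : lip01 g -> lip01 (fun t => g t ^+ n).
Proof.
move=> gL; elim: n => [|n ih]; first exact: lip01_cst.
by under eq_fun do rewrite exprS; exact: lip01M.
Qed.

(** A Lipschitz derivative is bounded on [0, 1], so the mean value theorem
applies. *)
Lemma lip01_deriv (g dg : R -> R) :
  (forall t, is_derive t (1 : R) g (dg t)) -> lip01 dg -> lip01 g.
Proof.
move=> gd /lip01_bounded[M dgM]; exists M.
suff H x y : 0 <= x -> x < y -> y <= 1 -> `|g y - g x| <= M * `|y - x|.
  move=> x y /andP[x0 x1] /andP[y0 y1]; have [xy|yx|->] := ltgtP x y.
  - by rewrite distrC (distrC x) H.
  - by rewrite H.
  - by rewrite !subrr normr0 mulr0.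
move=> x0 xy y1.
have gc : {within `[x, y], continuous g}.
  by apply: derivable_within_continuous => z _; exact: (gd z).(ex_derive).
have [c /itvP cxy ->] := MVT xy (fun z _ => gd z) gc.
by rewrite normrM ler_wpM2r// dgM// (le_trans x0) ?cxy//= (le_trans _ y1) ?cxy.
Qed.

End LipschitzFTC.

(** * Taylor's formula with a Lipschitz last derivative *)

Section TaylorLipschitz.
Variable R : realType.
Local Notation mu := (@lebesgue_measure R).

(** The Taylor polynomial of phi 0 at t, evaluated at 1: its derivative in t
telescopes to the integrand of the remainder. *)
Let taylor_at1 (n : nat) (phi : nat -> R -> R) (t : R) : R :=
  \sum_(k < n.+1) phi k t * (1 - t) ^+ k / k`!%:R.

Lemma taylor_at1_is_derive n (phi : nat -> R -> R) (t d : R) :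
  (forall k, (k < n)%N -> is_derive t (1 : R) (phi k) (phi k.+1 t)) ->
  is_derive t (1 : R) (phi n) d ->
  is_derive t (1 : R) (taylor_at1 n phi) (d * (1 - t) ^+ n / n`!%:R).
Proof.
elim: n d => [|n ih] d phiD phin.
  rewrite (_ : taylor_at1 0 phi = phi 0%N); last first.
    apply/funext => u; rewrite /taylor_at1 big_ord_recl big_ord0 addr0.
    by rewrite expr0 fact0 mulr1 divr1.
  by rewrite expr0 fact0 mulr1 divr1.
rewrite (_ : taylor_at1 n.+1 phi = taylor_at1 n phi +
  (fun u => (n.+1`!%:R^-1 : R) *: (phi n.+1 u * (1 - u) ^+ n.+1))); last first.
  apply/funext => u; rewrite /taylor_at1 big_ord_recr/=.
  by rewrite [X in _ = X]/(_ + _) [X in _ + X]mulrC.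
have dT : is_derive t (1 : R) (taylor_at1 n phi) (phi n.+1 t * (1 - t) ^+ n / n`!%:R).
  by apply: ih => [k kn|]; apply: phiD => //; exact: ltnW.
have dX : is_derive t (1 : R) (fun u : R => (1 - u) ^+ n.+1) (- (n.+1%:R * (1 - t) ^+ n)).
  have := is_deriveX n.+1 (is_deriveB (is_derive_cst (1 : R) t 1) (is_derive_id t (1 : R))).
  by rewrite exprfctE sub0r scalerN scaler1.
have := is_deriveD dT (is_deriveZ (n.+1`!%:R^-1 : R) (is_deriveM phin dX)).
congr (is_derive _ _ _ _); rewrite /GRing.scale/= exprS factS natrM.
by field; rewrite nat1r !pnatr_eq0 -lt0n fact_gt0.
Qed.

Let ae_neq (a : R) : {ae mu, forall t, t != a}.
Proof.
exists [set a]; split; [exact: measurable_set1|exact: lebesgue_measure_set1|].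
by move=> t /= /negP; rewrite negbK => /eqP.
Qed.

(** The function taylor_at1 n phi goes from the Taylor sum at 0 to phi 0 1, and it
is Lipschitz because phi 0, ..., phi n are; where phi n is differentiable its
derivative is the integrand. *)
Lemma lip01_Taylor n (phi : nat -> R -> R) :
  (forall t k, (k < n)%N -> is_derive t (1 : R) (phi k) (phi k.+1 t)) ->
  lip01 (phi n) ->
  phi 0%N 1 - phi 0%N 0 = \sum_(1 <= k < n.+1) phi k 0 / k`!%:R +
    \int[mu]_(t in `[0, 1]) (derive1 (phi n) t * (1 - t) ^+ n / n`!%:R).
Proof.
move=> phiD phin.
have philip k : (k <= n)%N -> lip01 (phi k).
  move=> /subKn <-; elim: (n - k)%N => [|j ih]; first by rewrite subn0.
  have [nj|jn] := leqP n j.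
    by move: ih; rewrite (eqP (nj : n - j == 0)%N) subnS (eqP (nj : n - j == 0)%N).
  apply: (@lip01_deriv _ _ (phi (n - j.+1).+1)); last by rewrite -subSn// subSS.
  by move=> t; apply: phiD; rewrite ltn_subrL (leq_trans _ jn).
have Tlip : lip01 (taylor_at1 n phi).
  have H j : (j <= n.+1)%N ->
      lip01 (fun t => \sum_(k < j) phi k t * (1 - t) ^+ k / k`!%:R).
    elim: j => [_|j ih jn].
      by under eq_fun do rewrite big_ord0; exact: lip01_cst.
    under eq_fun do rewrite big_ord_recr/=.
    apply: lip01D; first exact/ih/ltnW.
    apply: lip01M; last exact: lip01_cst.
    by apply: lip01M; [exact: philip|exact/lip01X/lip01_onem].
  exact: H.
have [h [h_int hE h_ae]] := lip01_FTC Tlip.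
have [dphi [_ _ p_ae]] := lip01_FTC phin.
have -> : \int[mu]_(t in `[0, 1]) (derive1 (phi n) t * (1 - t) ^+ n / n`!%:R) =
    \int[mu]_(t in `[0, 1]) h t.
  rewrite /Rintegral; congr fine; apply: ae_eq_integral_nonmeasurable.
  have aeF := ae_filter_ringOfSetsType mu.
  apply: filterS3 h_ae p_ae (filterI (ae_neq 0) (ae_neq 1)).
  move=> t /= hT phiT [t0 t1]; rewrite in_itv/= => /andP[t_ge0 t_le1].
  have t01 : 0 < t < 1 by rewrite !lt_neqAle eq_sym t0 t_ge0 t1 t_le1.
  have [_ <-] := hT t01; have [dphin _] := phiT t01; congr (_%:E).
  have phin1 : is_derive t (1 : R) (phi n) (derive1 (phi n) t).
    by split => //; rewrite derive1E.
  by rewrite [RHS]derive1E (taylor_at1_is_derive (phiD t) phin1).(derive_val).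
rewrite hE.
have T1 : taylor_at1 n phi 1 = phi 0%N 1.
  rewrite /taylor_at1 big_ord_recl/= expr0 fact0 mulr1 divr1 big1 ?addr0// => k _.
  by rewrite subrr exprS mul0r mulr0 mul0r.
have T0 : taylor_at1 n phi 0 = phi 0%N 0 + \sum_(1 <= k < n.+1) phi k 0 / k`!%:R.
  rewrite /taylor_at1 -(big_mkord xpredT (fun k => phi k 0 * (1 - 0) ^+ k / k`!%:R)).
  rewrite big_nat_recl// subr0 expr0 fact0 mulr1 divr1 big_add1/=; congr (_ + _).
  by apply: eq_bigr => k _; rewrite expr1n mulr1.
by rewrite T1 T0; ring.
Qed.

End TaylorLipschitz.

(** * Iterated directional derivatives *)

Section Directional.
Variable R : realType.
Implicit Types (F G : R * R -> R) (u v w P x : R * R).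

Lemma dird_derive F x v : differentiable F x -> dird v F x = derive F x v.
Proof.
move=> dF; rewrite /dird /d1 /d2 !deriveE//.
rewrite -[v in RHS](_ : v.1 *: (1, 0) + v.2 *: (0, 1) = _).
  by rewrite linearD !linearZ.
by case: v => a b; rewrite /GRing.scale/=; congr pair; rewrite /= /GRing.scale/=; ring.
Qed.

Lemma is_derive_line F P v (t : R) : differentiable F (P + t *: v) ->
  is_derive t (1 : R) (fun r : R => F (P + r *: v)) (dird v F (P + t *: v)).
Proof.
move=> dF; rewrite (dird_derive v dF).
have E : (fun h : R => h^-1 *: (((fun r : R => F (P + r *: v)) \o shift t) (h *: 1) -
    F (P + t *: v))) = (fun h : R => h^-1 *: ((F \o shift (P + t *: v)) (h *: v) -
    F (P + t *: v))).
  apply/funext => h /=; congr (_ *: (F _ - _)).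
  by rewrite [h *: 1]mulr1 scalerDl addrCA.
have := diff_derivable (v := v) dF.
by split; rewrite /derivable/derive E.
Qed.

(** The mean value theorem in the direction u and then in the direction v. The
left-hand side is symmetric in u and v up to rearrangement, hence [dirdC]. *)
Lemma mixed_MVT F u v P (h : R) : 0 < h -> (forall x, differentiable F x) ->
    (forall x, differentiable (dird u F) x) ->
  exists s t : R, [/\ 0 < s < h, 0 < t < h &
    F (P + h *: u + h *: v) - F (P + h *: u) - (F (P + h *: v) - F P) =
    h ^+ 2 * dird v (dird u F) (P + s *: u + t *: v)].
Proof.
move=> h0 dF duF.
pose g r := F (P + h *: v + r *: u) - F (P + r *: u).
have dg (r : R) : is_derive r (1 : R) g
    (dird u F (P + h *: v + r *: u) - dird u F (P + r *: u)).
  by apply: is_deriveB; exact: is_derive_line.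
have cg : {within `[0, h], continuous g}.
  by apply: derivable_within_continuous => z _; exact: (dg z).(ex_derive).
have [s sh gE] := MVT h0 (fun z _ => dg z) cg.
pose k r := dird u F (P + s *: u + r *: v).
have dk (r : R) : is_derive r (1 : R) k (dird v (dird u F) (P + s *: u + r *: v)).
  exact: is_derive_line.
have ck : {within `[0, h], continuous k}.
  by apply: derivable_within_continuous => z _; exact: (dk z).(ex_derive).
have [t th kE] := MVT h0 (fun z _ => dk z) ck.
exists s, t; split; [by move: sh; rewrite in_itv|by move: th; rewrite in_itv|].
move: gE kE; rewrite /g /k !scale0r !addr0 !subr0 => gE kE.
by rewrite [P + h *: u + _]addrAC gE [P + h *: v + _]addrAC kE; ring.
Qed.

(** Both mixed derivatives, taken at suitable points arbitrarily close to x, are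
equal to the same second difference quotient; continuity does the rest. *)
Lemma dirdC F u v x : Cn 2 F -> dird u (dird v F) x = dird v (dird u F) x.
Proof.
move=> CF; have [dF _ _] := CF.
have dd w y : differentiable (dird w F) y by have [+ _ _] := Cn_dird w CF; exact.
have cc w w' : continuous (dird w (dird w' F)).
  by apply: (Cn_cont (n := 0)); apply/Cn_dird/Cn_dird.
apply/eqP; rewrite -subr_eq0 -normr_le0; apply/ler_addgt0Pr => e e0; rewrite add0r.
have near_x w w' a b : \forall z \near ((0, 0) : R * R),
    `|dird w (dird w' F) x - dird w (dird w' F) (x + z.1 *: a + z.2 *: b)| <= e / 2.
  have line_cvg : (x + z.1 *: a + z.2 *: b) @[z --> ((0, 0) : R * R)] --> x.
    suff : (x + z.1 *: a + z.2 *: b) @[z --> ((0, 0) : R * R)] -->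
        x + (0 : R) *: a + (0 : R) *: b by rewrite !scale0r !addr0.
    apply: cvgD; [apply: cvgD; [exact: cvg_cst|]|]; apply: cvgZl.
      exact: cvg_fst.
    exact: cvg_snd.
  have := cvg_comp _ _ line_cvg (cc w w' x).
  by move=> /cvgrPdist_le/(_ (e / 2)); apply; rewrite divr_gt0.
have [d /= d0 dP] := (nbhs_ballP _ _).1 (filterI (near_x u v v u) (near_x v u u v)).
have h0 : 0 < d / 2 by rewrite divr_gt0.
have hN0 : (d / 2) ^+ 2 != 0 by rewrite expf_neq0// gt_eqF.
have [s [t [s_h t_h E1]]] := @mixed_MVT F v u x _ h0 dF (dd v).
have [s' [t' [s'_h t'_h E2]]] := @mixed_MVT F u v x _ h0 dF (dd u).
have in_ball (p q : R) : 0 < p < d / 2 -> 0 < q < d / 2 -> ball ((0, 0) : R * R) d (p, q).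
  have lt_d : d / 2 < d by rewrite ltr_pdivrMr// ltr_pMr// ltr1n.
  have ball0 (r : R) : 0 < r < d / 2 -> ball (0 : R) d r.
    move=> /andP[r0 rd]; rewrite -ball_normE /ball_ /= sub0r normrN gtr0_norm//.
    exact: lt_trans lt_d.
  by move=> pd qd; split; exact: ball0.
have [/= near1 _] := dP _ (in_ball _ _ s_h t_h).
have [/= _ near2] := dP _ (in_ball _ _ s'_h t'_h).
rewrite [x + _ *: v + _]addrAC in E1.
have swap (a b c r : R) : a - b - (c - r) = a - c - (b - r) by ring.
have E := etrans (esym E1) (etrans (swap _ _ _ _) E2).
move/(mulfI hN0) in E; rewrite -E distrC in near2.
move: near1 near2; move: (dird _ _ (x + s *: v + t *: u)) => A near1 near2.
apply: (le_trans (ler_distD A _ _)); apply: (le_trans (lerD near1 near2)).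
rewrite -splitr; apply: lexx.
Qed.

Lemma Cn_S n F : Cn n.+1 F -> Cn n F.
Proof.
elim: n F => [|n ih] F; first by move=> CF; exact: (@Cn_cont R 1 F CF).
by move=> [dF F1 F2]; split; [exact: dF|exact: ih F1|exact: ih F2].
Qed.

Lemma Cn_le n m F : (n <= m)%N -> Cn m F -> Cn n F.
Proof. by move=> /subnK <-; elim: (m - n)%N => //= k ih /Cn_S. Qed.

Lemma Cn_partial a b n F : Cn (a + b + n) F -> Cn n (partial a b F).
Proof.
rewrite /partial; elim: a n => [|a ih] n CF; last first.
  have [] // : Cn n.+1 (iter a (@d1 R) (iter b (@d2 R) F)).
  by apply: ih; rewrite addnS -!addSn.
rewrite add0n in CF; elim: b n CF => [|b ih] n CF; first exact: CF.
by have [] : Cn n.+1 (iter b (@d2 R) F) by apply: ih; rewrite addnS -addSn.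
Qed.

Lemma partial_differentiable a b n F x : Cn n F -> (a + b < n)%N ->
  differentiable (partial a b F) x.
Proof.
move=> CF abn; have : Cn (a + b + 1) F by apply: Cn_le CF; rewrite addn1.
by move=> /Cn_partial[].
Qed.

Lemma d2_partial a b F : Cn (a + b).+1 F -> d2 (partial a b F) = partial a b.+1 F.
Proof.
elim: a => // a ih CF; apply/funext => x.
have : Cn 2 (partial a b F) by apply: Cn_partial; rewrite addn2.
move=> /(dirdC (0, 1) (1, 0) x); rewrite !dird1 !dird2 => ->.
by rewrite ih//; exact: Cn_S.
Qed.

Lemma derive_sum (n : nat) (c : nat -> R) (H : nat -> R * R -> R) x v :
  (forall k, (k < n)%N -> differentiable (H k) x) ->
  differentiable (fun y => \sum_(k < n) c k * H k y) x /\
  derive (fun y => \sum_(k < n) c k * H k y) x v = \sum_(k < n) c k * derive (H k) x v.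
Proof.
elim: n => [|n ih] dH.
  under eq_fun do rewrite big_ord0.
  by rewrite big_ord0; split; [exact: differentiable_cst|exact: derive_cst].
have [|dS SE] := ih; first by move=> k /ltnW; exact: dH.
have E : (fun y => \sum_(k < n.+1) c k * H k y) =
    (fun y => 1 * (\sum_(k < n) c k * H k y) + c n * H n y).
  by apply/funext => y; rewrite big_ord_recr mul1r.
have dHn : differentiable (H n) x by apply: dH.
have dE := Defs.dlin 1 (c n) v dS dHn.
split; last by rewrite E [LHS]dE SE mul1r big_ord_recr.
rewrite E (_ : (fun y => _) =
  1 *: (fun y => \sum_(k < n) c k * H k y : R) + c n *: H n); last exact/funext.
by apply: differentiableD; exact: differentiableZ.
Qed.

(** The derivation v.1 d1 + v.2 d2, with d1 written 'X and d2 written 1: a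
homogeneous operator of known order is recovered from its dehomogenization. *)
Definition symbol v : {poly R} := v.1 *: 'X + v.2%:P.

(** The homogeneous operator of order n with dehomogenized symbol p, applied to
F. *)
Definition jet F (n : nat) (p : {poly R}) x : R :=
  \sum_(k < n.+1) p`_k * partial k (n - k) F x.

(** Composition with a directional derivative is multiplication of symbols; the
symmetry of second derivatives enters in [d2_partial]. *)
Lemma dird_jet F n (p : {poly R}) w x : Cn n.+1 F -> (size p <= n.+1)%N ->
  dird w (jet F n p) x = jet F n.+1 (symbol w * p) x.
Proof.
move=> CF sp.
have dP k : (k < n.+1)%N -> differentiable (partial k (n - k) F) x.
  by move=> kn; apply: (partial_differentiable _ CF); rewrite subnKC.
have [_ D1E] := derive_sum (fun k => p`_k) (1, 0) dP.
have [_ D2E] := derive_sum (fun k => p`_k) (0, 1) dP.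
rewrite /dird {1}/d1 {1}/d2 D1E D2E !mulr_sumr.
transitivity (\sum_(k < n.+2) w.1 * (('X * p)`_k * partial k (n.+1 - k) F x) +
              \sum_(k < n.+2) w.2 * (p`_k * partial k (n.+1 - k) F x)).
  congr (_ + _).
    rewrite [RHS]big_ord_recl coefXM/= mul0r mulr0 add0r; apply: eq_bigr => k _.
    by rewrite coefXM/= subSS.
  rewrite [RHS]big_ord_recr/= nth_default// mul0r mulr0 addr0.
  apply: eq_bigr => k _; congr (_ * (_ * _)).
  have kn : (k <= n)%N by rewrite -ltnS.
  rewrite -[LHS]/(d2 (partial k (n - k) F) x) d2_partial; last by rewrite subnKC.
  by rewrite subSn.
rewrite -big_split/=; apply: eq_bigr => k _.
by rewrite /symbol mulrDl coefD -scalerAl coefZ coefCM; ring.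
Qed.

Lemma size_symb v : (size (symbol v) <= 2)%N.
Proof.
rewrite (leq_trans (size_polyD _ _))// geq_max (leq_trans (size_scale_leq _ _)) ?size_polyX//.
by rewrite (leq_trans (size_polyC_leq1 _)).
Qed.

Lemma size_prod_symb (ws : seq (R * R)) :
  (size (\prod_(w <- ws) symbol w)%R <= (size ws).+1)%N.
Proof.
elim: ws => [|w ws ih]; first by rewrite big_nil size_poly1.
rewrite big_cons (leq_trans (size_polyMleq _ _))// -subn1 leq_subLR.
by rewrite (leq_trans (leq_add (size_symb w) ih)).
Qed.

(** This moves all computations with directional derivatives of F into the
commutative ring of polynomials. *)
Lemma foldr_dird_jet F (ws : seq (R * R)) x : Cn (size ws) F ->
  foldr (@dird R) F ws x = jet F (size ws) (\prod_(w <- ws) symbol w) x.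
Proof.
elim: ws x => [|w ws ih] x /= CF.
  by rewrite big_nil /jet big_ord_recl big_ord0 addr0 coefC mul1r.
rewrite (_ : foldr _ F ws = jet F (size ws) (\prod_(w <- ws) symbol w)); last first.
  by apply/funext => y; apply: ih; exact: Cn_S.
by rewrite big_cons dird_jet// size_prod_symb.
Qed.

End Directional.

(** * Bernoulli polynomials and exponentials *)

Section Combinatorics.

(** Summation over a triangle by antidiagonals. Its use is to collect terms by
total degree. *)
Lemma sum_triangle (V : nmodType) (a : nat -> nat -> V) (m : nat) :
  \sum_(1 <= i < m.+1) \sum_(1 <= j < (m - i + 1).+1) a i j =
  \sum_(1 <= n < m.+1) \sum_(1 <= i < n.+1) a i (n + 1 - i)%N.
Proof.
elim: m => [|m ih]; first by rewrite !big_geq.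
rewrite [RHS]big_nat_recr//= -ih [LHS]big_nat_recr//= subnn big_nat1.
rewrite [X in _ = _ + X]big_nat_recr//= [in RHS]addnC addnK addrA; congr (_ + _).
rewrite -big_split/=; apply: eq_big_nat => i /andP[i1 im].
have {}im : (i <= m)%N by [].
by rewrite !addn1 (subSn (leqW im)) (subSn im) big_nat_recr.
Qed.

Variable R : realType.
Implicit Types (p q : {poly R}) (l s U W : R).

Lemma primitive_lin (c : R) p q :
  primitive (c *: p + q) = c *: primitive p + primitive q.
Proof.
apply/polyP => i; rewrite coefD coefZ !coef_primitive coefD coefZ.
by rewrite mulrnDl -mulrnAr; ring.
Qed.

Lemma primitive0 : primitive (0 : {poly R}) = 0.
Proof. by apply/polyP => i; rewrite coef_primitive !coef0 mul0rn mul0r. Qed.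

Lemma primitive_sum (n : nat) (c : nat -> R) (p : nat -> {poly R}) :
  primitive (\sum_(i < n) c i *: p i) = \sum_(i < n) c i *: primitive (p i).
Proof.
elim: n => [|n ih]; first by rewrite !big_ord0 primitive0.
by rewrite !big_ord_recr/= addrC primitive_lin ih addrC.
Qed.

Lemma primitiveXn1 k : (primitive ('X^k : {poly R})).[1] = k.+1%:R^-1.
Proof.
rewrite [primitive _](_ : _ = k.+1%:R^-1 *: 'X^(k.+1)).
  by rewrite hornerZ hornerXn expr1n mulr1.
apply/polyP => i; rewrite coef_primitive coefZ !coefXn.
case: i => [|i]; first by rewrite mulr0n mul0r mulr0.
rewrite mulr1n eqSS /=; have [->|_] := eqVneq i k; last by rewrite mul0r mulr0.
by rewrite mul1r mulr1.
Qed.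

Lemma deriv_eq0 p : p^`() = 0 -> p = (p.[0])%:P.
Proof.
move=> p0; apply/polyP => -[|i]; rewrite coefC horner_coef0//=.
have /eqP := congr1 (fun q : {poly R} => q`_i) p0.
by rewrite coef_deriv coef0 mulrn_eq0/= => /eqP.
Qed.

(** The coefficient of z^(n+1) in (exp z - 1) * sum_j B_j(x) z^j / j! =
z exp (x z). By induction the two sides have the same derivative, and both
integrate to 1 / (n + 1)! over [0, 1]. *)
Lemma bernoulli_sum n :
  \sum_(j < n.+1) (j`!%:R * (n.+1 - j)`!%:R)^-1 *: bernoulli R j =
  (n`!%:R)^-1 *: 'X^n.
Proof.
elim: n => [|n ih].
  by rewrite big_ord_recl big_ord0 addr0 !fact0 mulr1 invr1 !scale1r.
set B := \sum_(_ < _) _; set X := RHS.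
suff : X + (-1) *: B = 0 by move/eqP; rewrite scaleN1r subr_eq0 => /eqP.
have d0 : (X + (-1) *: B)^`() = 0.
  rewrite derivD derivZ derivZ derivXn /B big_ord_recl linearD/= derivZ derivC scaler0 add0r.
  rewrite linear_sum/= [X in _ + -1 *: X](_ : _ = (n`!%:R)^-1 *: 'X^n); last first.
    rewrite -ih; apply: eq_bigr => j _.
    rewrite derivZ [_^`()]deriv_bernoulli scalerA /bump/= add1n subSS; congr (_ *: _).
    rewrite factS natrM; field.
    by rewrite nat1r !pnatr_eq0 -!lt0n !fact_gt0.
  rewrite scaleN1r -['X^n *+ _]scaler_nat scalerA factS natrM.
  rewrite (_ : _ * n.+1%:R = (n`!%:R)^-1) ?subrr//.
  by field; rewrite nat1r !pnatr_eq0 -!lt0n !fact_gt0.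
have I0 : (primitive (X + (-1) *: B)).[1] = 0.
  rewrite addrC primitive_lin /X -[_ *: 'X^_]addr0 primitive_lin primitive0 addr0.
  rewrite /B (primitive_sum _ (fun j => (j`!%:R * (n.+2 - j)`!%:R)^-1) (bernoulli R)).
  rewrite big_ord_recl hornerD !hornerZ hornerD horner_sum big1 => [|j _]; last first.
    by rewrite hornerZ -Rintegral_poly Rintegral_bernoulli mulr0.
  rewrite hornerZ fact0 mul1r subn0.
  rewrite -[bernoulli R ord0]/('X^0) !primitiveXn1 (factS n.+1) natrM invr1 mulr1 addr0.
  by rewrite mulN1r [X in _ + X]mulrC -invfM addNr.
have [c cE] : exists c, X + (-1) *: B = c *: 'X^0 + 0.
  by exists (X + (-1) *: B).[0]; rewrite addr0 alg_polyC; exact: deriv_eq0.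
move: I0; rewrite cE primitive_lin primitive0 !addr0 hornerZ primitiveXn1 invr1.
by rewrite mulr1 => ->; rewrite scale0r.
Qed.

Lemma bernS0 j : (bernS R j).[0] = 0.
Proof. by rewrite /bernS hornerD hornerN hornerC subrr. Qed.

Lemma size_bernS j : (size (bernS R j) <= j.+1)%N.
Proof.
rewrite (leq_trans (size_polyD _ _))// geq_max size_bernoulli/=.
by rewrite size_polyN (leq_trans (size_polyC_leq1 _)).
Qed.

(** The same identity for S_j, obtained by integrating [bernoulli_sum] from 0. *)
Lemma bernS_sum n : (0 < n)%N ->
  \sum_(1 <= j < n.+1) (j`!%:R * (n + 1 - j)`!%:R)^-1 *: bernS R j =
  (n`!%:R)^-1 *: 'X^n.
Proof.
case: n => // n _; apply/eqP; rewrite -subr_eq0; apply/eqP.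
rewrite [LHS]deriv_eq0.
  rewrite hornerD hornerN hornerZ hornerXn expr0n mulr0 subr0 horner_sum big1 ?polyC0// => j _.
  by rewrite hornerZ bernS0 mulr0.
rewrite derivB derivZ derivXn big_add1/= big_mkord linear_sum/=.
rewrite (_ : \sum_(_ < _) _ = (n`!%:R)^-1 *: 'X^n); last first.
  rewrite -bernoulli_sum; apply: eq_bigr => j _.
  rewrite derivZ derivB derivC subr0 deriv_bernoulli scalerA addn1 subSS; congr (_ *: _).
  rewrite factS natrM; field.
  by rewrite nat1r !pnatr_eq0 -!lt0n !fact_gt0.
rewrite -['X^n *+ _]scaler_nat scalerA factS natrM.
rewrite (_ : _ * n.+1%:R = (n`!%:R)^-1) ?subrr//.
by field; rewrite nat1r !pnatr_eq0 -!lt0n !fact_gt0.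
Qed.

(** [bernS_sum] divided by the variable; stated for the quotients so that it
still makes sense at s = 0. *)
Lemma bernS_divX_sum n s : (0 < n)%N ->
  \sum_(1 <= j < n.+1) (bernS R j %/ 'X).[s] / (j`!%:R * (n + 1 - j)`!%:R) =
  s ^+ n.-1 / n`!%:R.
Proof.
case: n => // n _; have := bernS_sum (ltn0Sn n).
have XE j : bernS R j = (bernS R j %/ 'X) * 'X.
  by rewrite divpK// -['X]subr0 dvdp_XsubCl rootE bernS0.
under eq_bigr do rewrite XE scalerAl.
rewrite -mulr_suml exprSr scalerAl => /(mulIf (negbT (polyX_eq0 R))).
move=> /(congr1 (fun p : {poly R} => p.[s])); rewrite hornerZ hornerXn horner_sum mulrC => <-.
by apply: eq_bigr => j _; rewrite hornerZ mulrC.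
Qed.

(** The homogenization s^i S_i(l / s) of S_i, a factor of [bernSS]. *)
Definition bernSh (i : nat) l s : R :=
  \sum_(k < i.+1) (bernS R i)`_k * l ^+ k * s ^+ (i - k).

(** [bernS_sum] homogenized: both sides are applied to the linear map sending
'X^k to l^k s^(n - k). *)
Lemma bernSh_sum n l s : (0 < n)%N ->
  \sum_(1 <= i < n.+1) bernSh i l s * s ^+ (n - i) / (i`!%:R * (n + 1 - i)`!%:R) =
  l ^+ n / n`!%:R.
Proof.
move=> n0.
pose hom p := \sum_(k < n.+1) p`_k * (l ^+ k * s ^+ (n - k)).
have homE i : (i <= n)%N -> bernSh i l s * s ^+ (n - i) = hom (bernS R i).
  move=> i_n; rewrite /bernSh /hom mulr_suml.
  rewrite -(big_mkord xpredT (fun k => (bernS R i)`_k * l ^+ k * s ^+ (i - k) * s ^+ (n - i))).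
  rewrite -[RHS](big_mkord xpredT (fun k => (bernS R i)`_k * (l ^+ k * s ^+ (n - k)))).
  rewrite [RHS](big_cat_nat (n := i.+1))//= [X in _ = _ + X]big1_seq ?addr0.
    apply: eq_big_nat => k /andP[_ ki]; rewrite -mulrA -exprD -mulrA; congr (_ * (_ * s ^+ _)).
    by rewrite addnC addnBA// subnK.
  move=> k /=; rewrite mem_index_iota => /andP[ik _].
  by rewrite nth_default ?mul0r//; exact: leq_trans (size_bernS i) ik.
have <- : hom ((n`!%:R)^-1 *: 'X^n) = l ^+ n / n`!%:R.
  rewrite /hom big_ord_recr/= big1 => [|k _].
    by rewrite add0r subnn coefZ coefXn eqxx !mulr1 mulrC.
  by rewrite coefZ coefXn ltn_eqF// mulr0 mul0r.
rewrite -bernS_sum//.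
transitivity (\sum_(1 <= i < n.+1) (i`!%:R * (n + 1 - i)`!%:R)^-1 * hom (bernS R i)).
  by apply: eq_big_nat => i /andP[_ i_n]; rewrite homE 1?mulrC.
rewrite /hom; under eq_bigr do rewrite mulr_sumr.
rewrite exchange_big/=; apply: eq_bigr => k _; rewrite coef_sum mulr_suml.
by apply: eq_bigr => i _; rewrite coefZ !mulrA.
Qed.

Lemma exprB_sum (q : nat) U W :
  (U ^+ q - W ^+ q) / q`!%:R = \sum_(1 <= p < q.+1)
    (U - W) ^+ p * W ^+ (q - p) / (p`!%:R * (q - p)`!%:R).
Proof.
have -> : U ^+ q = (W + (U - W)) ^+ q by rewrite addrC subrK.
rewrite exprDn -(big_mkord xpredT (fun i => W ^+ (q - i) * (U - W) ^+ i *+ 'C(q, i))).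
rewrite big_nat_recl// big_add1 subn0 expr0 mulr1 bin0 mulr1n addrAC subrr add0r mulr_suml.
apply: eq_big_nat => i /andP[_ iq].
have f0 k : (k`!%:R : R) != 0 by rewrite pnatr_eq0 -lt0n fact_gt0.
apply/eqP; rewrite eqr_div ?mulf_neq0// -[_ *+ _]mulr_natr -(bin_fact iq) !natrM.
by apply/eqP; ring.
Qed.

(** The degree n part of exp (s W) - 1 + exp (s W) (exp (l (U - W)) - 1) =
exp (l U + (s - l) W) - 1, the left-hand side being expanded with the generating
function of the S_j. Summing over j removes S_j(s); expanding U^q - W^q in powers
of U - W makes the remaining sum over i an instance of [bernSh_sum]. *)
Lemma bernoulli_exp_identity n U W l s : (0 < n)%N ->
  \sum_(1 <= j < n.+1) W ^+ n * ((bernS R j).[s] / j`!%:R) / (n + 1 - j)`!%:R +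
  \sum_(1 <= i < n.+1) \sum_(1 <= j < (n - i + 1).+1)
    (U ^+ (n + 1 - i) - W ^+ (n + 1 - i)) * (U - W) ^+ i.-1 *
      (bernSS i j l s / (i`!%:R * j`!%:R)) / (n + 2 - i - j)`!%:R =
  (l * U + (s - l) * W) ^+ n / n`!%:R.
Proof.
move=> n0.
have -> : \sum_(1 <= j < n.+1) W ^+ n * ((bernS R j).[s] / j`!%:R) / (n + 1 - j)`!%:R =
    (s * W) ^+ n / n`!%:R.
  have /(congr1 (fun p : {poly R} => p.[s])) := bernS_sum n0.
  rewrite hornerZ hornerXn horner_sum exprMn mulrAC [_ / _]mulrC => <-.
  rewrite mulr_suml; apply: eq_bigr => j _; rewrite hornerZ invfM; ring.
pose a (i p : nat) := (U - W) ^+ (p + i).-1 * W ^+ (n + 1 - i - p) * bernSh i l s * s ^+ (n - i)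
  / (i`!%:R * p`!%:R * (n + 1 - i - p)`!%:R).
transitivity ((s * W) ^+ n / n`!%:R +
    \sum_(1 <= i < n.+1) \sum_(1 <= p < (n - i + 1).+1) a i p).
  congr (_ + _); apply: eq_big_nat => i /andP[i1 i_n].
  have nE : (n + 1 - i = n - i + 1)%N by rewrite addnBAC.
  have := exprB_sum (n + 1 - i) U W.
  have := @bernS_divX_sum (n + 1 - i) s; rewrite nE addn1 => /(_ isT).
  rewrite /= => SE BE.
  transitivity ((U ^+ (n - i).+1 - W ^+ (n - i).+1) / (n - i).+1`!%:R *
      ((U - W) ^+ i.-1 * bernSh i l s * s ^+ (n - i) / i`!%:R)); last first.
    rewrite BE mulr_suml; apply: eq_big_nat => p /andP[p1 pn].
    have pi : ((p + i).-1 = p + i.-1)%N by rewrite -{1}(prednK i1) addnS.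
    by rewrite /a nE addn1 pi exprD !invfM; ring.
  transitivity ((U ^+ (n - i).+1 - W ^+ (n - i).+1) * (U - W) ^+ i.-1 * bernSh i l s / i`!%:R *
      (s ^+ (n - i) / (n - i).+1`!%:R)); last by ring.
  rewrite -SE mulr_sumr; apply: eq_big_nat => j _.
  have -> : (n + 2 - i - j = (n - i).+1 + 1 - j)%N by rewrite -addnBAC// addnS.
  have -> : bernSS i j l s = bernSh i l s * (bernS R j %/ 'X).[s] by [].
  by rewrite !invfM; ring.
rewrite sum_triangle.
transitivity ((s * W) ^+ n / n`!%:R +
   \sum_(1 <= r < n.+1) (l * (U - W)) ^+ r * (s * W) ^+ (n - r) / (r`!%:R * (n - r)`!%:R)).
  congr (_ + _); apply: eq_big_nat => r /andP[r1 rn].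
  transitivity ((U - W) ^+ r * (s * W) ^+ (n - r) / (n - r)`!%:R * (l ^+ r / r`!%:R)).
    rewrite -(bernSh_sum l s r1) mulr_sumr; apply: eq_big_nat => i /andP[i1 ir].
    rewrite /a.
    have ir1 : (i <= r + 1)%N by rewrite addn1 ltnW.
    have in1 : (i <= n + 1)%N by rewrite (leq_trans ir1)// leq_add2r.
    have -> : ((r + 1 - i + i).-1 = r)%N by rewrite subnK// addn1.
    have -> : (n + 1 - i - (r + 1 - i) = n - r)%N by rewrite subnBA// subnK// subnDr.
    have -> : (n - i = (n - r) + (r - i))%N by rewrite addnBA// subnK.
    by rewrite exprMn exprD !invfM; ring.
  by rewrite !exprMn !invfM; ring.
have -> : (l * U + (s - l) * W) ^+ n = (l * U + (s - l) * W) ^+ n - (s * W) ^+ n + (s * W) ^+ n.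
  by rewrite subrK.
rewrite mulrDl exprB_sum addrC; congr (_ + _).
by apply: eq_bigr => r _; congr (_ ^+ _ * _ / _); ring.
Qed.

End Combinatorics.

(** * Directional derivatives along the sides of the triangle *)

Section Assembly.
Variable R : realType.
Implicit Types (F : R * R -> R) (p q : {poly R}) (u v w x V P : R * R).

Lemma jetD F n p q x : jet F n (p + q) x = jet F n p x + jet F n q x.
Proof. by rewrite /jet -big_split/=; apply: eq_bigr => k _; rewrite coefD mulrDl. Qed.

Lemma jetZ F n (c : R) p x : jet F n (c *: p) x = c * jet F n p x.
Proof. by rewrite /jet mulr_sumr; apply: eq_bigr => k _; rewrite coefZ mulrA. Qed.

Lemma jet_sum F n I (r : seq I) (p : I -> {poly R}) x :
  jet F n (\sum_(i <- r) p i) x = \sum_(i <- r) jet F n (p i) x.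
Proof.
elim: r => [|i r ih]; last by rewrite !big_cons jetD ih.
by rewrite !big_nil /jet big1// => k _; rewrite coef0 mul0r.
Qed.

Lemma symbD u v : symbol (u + v) = symbol u + symbol v.
Proof. by rewrite /symbol /= scalerDl polyCD; ring. Qed.

Lemma symbZ (c : R) v : symbol (c *: v) = c *: symbol v.
Proof.
rewrite /symbol -[(c *: v).1]/(c * v.1) -[(c *: v).2]/(c * v.2).
by rewrite -!mul_polyC !polyCM; ring.
Qed.

Lemma symbB u v : symbol (u - v) = symbol u - symbol v.
Proof. by rewrite symbD -scaleN1r symbZ scaleN1r. Qed.

Lemma foldr_nseq F n w : foldr (@dird R) F (nseq n w) = iter n (dird w) F.
Proof. by elim: n => //= n ->. Qed.

Lemma Cn_foldr n F (ws : seq (R * R)) : Cn (size ws + n) F -> Cn n (foldr (@dird R) F ws).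
Proof.
elim: ws n => //= w ws ih n CF; apply: Cn_dird; apply: ih.
by rewrite addnS -addSn.
Qed.

Lemma segment_in (D : set (R * R)) V1 V (t : R) :
  convex_set (D : set (convex_lmodType (R * R)%type)) ->
  D V1 -> D V -> 0 <= t <= 1 -> D (V1 + t *: (V - V1)).
Proof.
move=> cD DV1 DV /andP[t0 t1].
have := cD V V1 (Itv01 t0 t1); rewrite !inE => /(_ DV DV1).
congr D; rewrite /conv /=; case: V1 {DV1} => a b; case: V {DV} => c d.
by rewrite /unstable.onem; congr pair => /=; rewrite /GRing.scale/=; ring.
Qed.

(** An iterated directional derivative of order m is a combination with constant
coefficients of the partial derivatives of order m. *)
Lemma lip01_line (D : set (R * R)) m F (ws : seq (R * R)) V1 V :
  convex_set (D : set (convex_lmodType (R * R)%type)) -> D V1 -> D V ->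
  Cn m F ->
  (forall j, (j <= m)%N -> [lipschitz partial (m - j) j F x | x in D]) ->
  size ws = m ->
  lip01 (fun t : R => foldr (@dird R) F ws (V1 + t *: (V - V1))).
Proof.
move=> cD DV1 DV CF lipF sm; subst m; under eq_fun do rewrite foldr_dird_jet//.
rewrite /jet; set p := \prod_(_ <- _) _.
have H j : (j <= (size ws).+1)%N -> lip01 (fun t : R =>
    \sum_(k < j) p`_k * partial k (size ws - k) F (V1 + t *: (V - V1))).
  elim: j => [_|j ih jm].
    by under eq_fun do rewrite big_ord0; exact: lip01_cst.
  under eq_fun do rewrite big_ord_recr/=.
  apply: lip01D; first exact/ih/ltnW.
  apply: lip01M; first exact: lip01_cst.
  have /pinfty_ex_gt0[K K0] := lipF _ (leq_subr j (size ws)).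
  rewrite subKn// => KL; exists (K * `|V - V1|) => s t s01 t01.
  have := KL (V1 + s *: (V - V1), V1 + t *: (V - V1)) _.
  rewrite /= => /(_ (conj (segment_in cD DV1 DV s01) (segment_in cD DV1 DV t01))).
  rewrite opprD addrACA subrr add0r -scalerBl normrZ.
  by rewrite mulrA mulrAC.
exact: H.
Qed.

(** [lip01_Taylor] for the restriction to the segment from V1 to V of an iterated
directional derivative of F, the Taylor coefficients being expressed by
symbols. *)
Lemma Taylor_line (D : set (R * R)) m F (ws : seq (R * R)) N V1 V :
  convex_set (D : set (convex_lmodType (R * R)%type)) -> D V1 -> D V ->
  Cn m F ->
  (forall j, (j <= m)%N -> [lipschitz partial (m - j) j F x | x in D]) ->
  (N + size ws = m)%N ->
  foldr (@dird R) F ws V - foldr (@dird R) F ws V1 =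
  \sum_(1 <= k < N.+1) jet F (k + size ws)
     (symbol (V - V1) ^+ k * \prod_(w <- ws) symbol w) V1 / k`!%:R +
  remainder V1 N (foldr (@dird R) F ws) V.
Proof.
move=> cD DV1 DV CF lipF sN; set w := V - V1.
have itE k : iter k (dird w) (foldr (@dird R) F ws) = foldr (@dird R) F (nseq k w ++ ws).
  by rewrite foldr_cat foldr_nseq.
pose phi k (t : R) := iter k (dird w) (foldr (@dird R) F ws) (V1 + t *: w).
have phiD t k : (k < N)%N -> is_derive t (1 : R) (phi k) (phi k.+1 t).
  move=> kN; apply: is_derive_line; rewrite itE.
  have : Cn 1 (foldr (@dird R) F (nseq k w ++ ws)).
    apply: Cn_foldr; apply: Cn_le CF.
    by rewrite size_cat size_nseq addn1 -sN -addSn leq_add2r.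
  by case.
have phiN : lip01 (phi N).
  rewrite /phi itE; apply: (lip01_line cD DV1 DV CF lipF).
  by rewrite size_cat size_nseq.
have := lip01_Taylor phiD phiN.
have V1E : V1 + w = V by rewrite /w addrC subrK.
rewrite {1 2}/phi scale1r scale0r addr0 V1E => ->.
congr (_ + _); apply: eq_big_nat => k /andP[_ kN]; congr (_ / _).
rewrite /phi scale0r addr0 itE foldr_dird_jet size_cat size_nseq; last first.
  by apply: Cn_le CF; rewrite -sN leq_add2r.
by congr (jet _ _ _ _); rewrite big_cat/= big_nseq iter_mulr_1.
Qed.

Lemma poly_horner_inj p q : (forall t, p.[t] = q.[t]) -> p = q.
Proof.
move=> pq; apply/eqP; rewrite -subr_eq0; apply/negPn/negP => pq0.
pose rs : seq R := [seq k%:R | k <- iota 0 (size (p - q))].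
have rs_root : all (root (p - q)) rs.
  by apply/allP => _ /mapP[k _ ->]; rewrite rootE hornerD hornerN pq subrr.
have rs_uniq : uniq rs.
  by rewrite map_inj_uniq ?iota_uniq// => a b /eqP; rewrite eqr_nat => /eqP.
by have := max_poly_roots pq0 rs_root rs_uniq; rewrite size_map size_iota ltnn.
Qed.

(** [bernoulli_exp_identity] for U and W polynomials, by evaluation. *)
Lemma bernoulli_exp_poly n (U W : {poly R}) (l s : R) : (0 < n)%N ->
  \sum_(1 <= j < n.+1) ((bernS R j).[s] / j`!%:R / (n + 1 - j)`!%:R) *: W ^+ n +
  \sum_(1 <= i < n.+1) \sum_(1 <= j < (n - i + 1).+1)
    (bernSS i j l s / (i`!%:R * j`!%:R) / (n + 2 - i - j)`!%:R) *:
    ((U ^+ (n + 1 - i) - W ^+ (n + 1 - i)) * (U - W) ^+ i.-1) =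
  (n`!%:R)^-1 *: (l *: U + (s - l) *: W) ^+ n.
Proof.
move=> n0; apply: poly_horner_inj => t.
have -> : ((n`!%:R)^-1 *: (l *: U + (s - l) *: W) ^+ n).[t] =
    (l * U.[t] + (s - l) * W.[t]) ^+ n / n`!%:R.
  by rewrite hornerZ horner_exp hornerD !hornerZ mulrC.
rewrite -bernoulli_exp_identity//.
rewrite hornerD !horner_sum; congr (_ + _).
  by apply: eq_bigr => j _; rewrite hornerZ horner_exp; ring.
apply: eq_bigr => i _; rewrite horner_sum; apply: eq_bigr => j _.
by rewrite hornerZ hornerM hornerD hornerN !horner_exp hornerD hornerN; ring.
Qed.

Lemma coef_symbX w n k : (k <= n)%N ->
  (symbol w ^+ n)`_k = w.1 ^+ k * w.2 ^+ (n - k) *+ 'C(n, k).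
Proof.
move=> kn; rewrite /symbol addrC exprDn coef_sum (bigD1 (Ordinal (kn : (k < n.+1)%N)))//=.
have E i : (w.2%:P ^+ (n - i) * (w.1 *: 'X) ^+ i *+ 'C(n, i))`_k =
    w.1 ^+ i * w.2 ^+ (n - i) *+ 'C(n, i) * (k == i)%:R.
  by rewrite coefMn -polyC_exp coefCM exprZn coefZ coefXn !mulrnAl; congr (_ *+ _); ring.
rewrite E eqxx mulr1 big1 ?addr0// => i ik.
by rewrite E eq_sym (_ : (_ == _) = false) ?mulr0//; apply/negbTE.
Qed.

(** The binomial formula for the powers of the derivation along x - V1. *)
Lemma taylorE m (D : set (R * R)) (f : R * R -> R) V1 x :
  taylor V1 m D f x = \sum_(n < m.+1)
    jet (ext m D f) n ((n`!%:R)^-1 *: symbol (x - V1) ^+ n) V1.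
Proof.
rewrite /taylor; set F := ext m D f.
pose c (a b : nat) := partial a b F V1 / (a`!%:R * b`!%:R)
    * (x.1 - V1.1) ^+ a * (x.2 - V1.2) ^+ b.
transitivity (\sum_(n < m.+1) \sum_(k < n.+1) c k (n - k)%N); last first.
  apply: eq_bigr => n _; rewrite jetZ /jet mulr_sumr; apply: eq_bigr => k _.
  have kn : (k <= n)%N by rewrite -ltnS.
  rewrite coef_symbX// /c /= -[_ *+ 'C(n, k)]mulr_natr.
  have f0 (i : nat) : (i`!%:R : R) != 0 by rewrite pnatr_eq0 -lt0n fact_gt0.
  have -> : ('C(n, k)%:R : R) = n`!%:R / (k`!%:R * (n - k)`!%:R).
    by apply: (mulIf (mulf_neq0 (f0 k) (f0 (n - k)%N))); rewrite divfK ?mulf_neq0// -!natrM bin_fact.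
  by field; rewrite !f0.
pose c' (a b : nat) := c a.-1 b.-1.
have := sum_triangle c' m.+1; rewrite !big_add1/= !big_mkord => H.
transitivity (\sum_(i < m.+1) \sum_(1 <= j < (m.+1 - i.+1 + 1).+1) c' i.+1 j).
  apply: eq_bigr => a _.
  have am : (a <= m)%N by rewrite -ltnS.
  rewrite big_add1/= subSS addn1 -subSn// big_mkord (big_ord_widen m.+1 (fun b => c a b)) ?leq_subr//.
  by apply: eq_bigl => b; rewrite ltn_subRL ltnS.
rewrite H; apply: eq_bigr => n _; rewrite big_add1 /= big_mkord; apply: eq_bigr => k _.
by rewrite /c' /= addn1 subSS subSn// -ltnS.
Qed.

(** The sign (-1)^(i+j) of the generalized Taylor polynomial undoes those of
D_12 = - U and D_32 = W - U, while in [sign_polyW] the sign (-1)^j exceeds those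
of D_13 = - W by one factor -1: the two sides at V1 contribute with opposite signs,
as needed for U^q - W^q. *)
Lemma sign_polyU (U W : {poly R}) i j k :
  ((-1) ^+ (i.+1 + j.+1) : R) *: (U ^+ k * ((- U) ^+ j * (W - U) ^+ i)) =
  U ^+ (k + j) * (U - W) ^+ i.
Proof.
rewrite -mul_polyC rmorphXn rmorphN1 -(opprB U W) (exprNn U) (exprNn (U - W)).
have sq (n : nat) : (-1) ^+ n * (-1) ^+ n = 1 :> {poly R} by rewrite -expr2 sqrr_sign.
transitivity (((-1) ^+ i * (-1) ^+ i) * ((-1) ^+ j * (-1) ^+ j) *
    (U ^+ (k + j) * (U - W) ^+ i)); last by rewrite !sq !mul1r.
by rewrite addSn addnS !exprS !exprD; ring.
Qed.

Lemma sign_polyW (U W : {poly R}) i j k :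
  ((-1) ^+ j.+1 : R) *: (W ^+ k * ((- W) ^+ j * (U - W) ^+ i)) =
  - (W ^+ (k + j) * (U - W) ^+ i).
Proof.
rewrite -mul_polyC rmorphXn rmorphN1 (exprNn W).
have sq : (-1) ^+ j * (-1) ^+ j = 1 :> {poly R} by rewrite -expr2 sqrr_sign.
transitivity (((-1) ^+ j * (-1) ^+ j) * - (W ^+ (k + j) * (U - W) ^+ i)).
  by rewrite exprS !exprD; ring.
by rewrite sq mul1r.
Qed.

End Assembly.

(** * The expansion of the generalized Taylor polynomial *)

Theorem theorem2p2 (R : realType) (m : nat) (hm : (1 <= m)%N)
  (D : set (R * R))
  (D_compact : compact D)
  (D_convex : convex_set (D : set (convex_lmodType (R * R)%type)))
  (D_interior : D° !=set0)
  (V1 V2 V3 : R * R) (DV1 : D V1) (DV2 : D V2) (DV3 : D V3)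
  (nondegenerate : det3 V1 V2 V3 != 0)
  (f : R * R -> R) (f_Cm1 : Cn1_on m D f)
  (x : R * R) (Dx : D x) :
  genTaylor V1 V2 V3 m D f x = taylor V1 m D f x + delta V1 V2 V3 m D f x.
Proof.
move: f_Cm1 => [[F0 F0ext] lipF].
have [CF Ff] : is_ext m D f (ext m D f) := xgetI f F0ext.
rewrite /genTaylor /delta taylorE; set F := ext m D f in CF Ff lipF *.
set l := lam2 V1 V2 V3 x; set s := l + lam3 V1 V2 V3 x.
pose U := symbol (V2 - V1); pose W := symbol (V3 - V1).
have hE : symbol (x - V1) = l *: U + (s - l) *: W.
  rewrite /U /W -!symbZ -symbD; congr symbol.
  rewrite /s addrAC subrr add0r /l /lam2 /lam3 !det3E; move: nondegenerate; rewrite det3E.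
  case: (V1) (V2) (V3) (x) => [a1 a2] [b1 b2] [c1 c2] [x1 x2] /= nd.
  by rewrite /GRing.scale/=; congr pair; rewrite /= /GRing.scale/=; field.
(* the terms of order k in the Taylor expansions of the differences *)
pose A (j k : nat) := jet F (k + j.-1) (W ^+ (k + j.-1)) V1 / k`!%:R *
  ((bernS R j).[s] / j`!%:R).
pose B (i j k : nat) := jet F (k + j.-1 + i.-1)
  ((U ^+ (k + j.-1) - W ^+ (k + j.-1)) * (U - W) ^+ i.-1) V1 / k`!%:R *
  (bernSS i j l s / (i`!%:R * j`!%:R)).
have AE j : (1 <= j < m.+1)%N ->
    (D1 V1 V2 V3 0 j.-1 F V3 - D1 V1 V2 V3 0 j.-1 F V1) * ((bernS R j).[s] / j`!%:R) =
    \sum_(1 <= k < (m - j + 1).+1) A j k +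
    remainder V1 (m - j + 1) (D1 V1 V2 V3 0 j.-1 F) V3 * ((bernS R j).[s] / j`!%:R).
  case: j => // j /andP[_ jm].
  have DE : D1 V1 V2 V3 0 j F = foldr (@dird R) F (nseq j (V3 - V1)).
    by rewrite foldr_nseq.
  rewrite -!pred_Sn DE (Taylor_line (N := m - j.+1 + 1) D_convex DV1 DV3 CF lipF); last first.
    by rewrite size_nseq -addnA add1n subnK.
  rewrite mulrDl mulr_suml; congr (_ + _); apply: eq_bigr => k _.
  by rewrite /A size_nseq big_nseq iter_mulr_1 exprD.
have BE i j : (1 <= i < m.+1)%N -> (1 <= j < (m - i + 1).+1)%N ->
    ((-1) ^+ (i + j) * (D2 V1 V2 V3 j.-1 i.-1 F V2 - D2 V1 V2 V3 j.-1 i.-1 F V1)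
       + (-1) ^+ j * (D3 V1 V2 V3 j.-1 i.-1 F V3 - D3 V1 V2 V3 j.-1 i.-1 F V1))
      * (bernSS i j l s / (i`!%:R * j`!%:R)) =
    \sum_(1 <= k < (m - i + 1 - j + 1).+1) B i j k +
    ((-1) ^+ (i + j) * remainder V1 (m + 2 - i - j) (D2 V1 V2 V3 j.-1 i.-1 F) V2
       + (-1) ^+ j * remainder V1 (m + 2 - i - j) (D3 V1 V2 V3 j.-1 i.-1 F) V3)
      * (bernSS i j l s / (i`!%:R * j`!%:R)).
  case: i => // i /andP[_ im]; case: j => // j /andP[_ jm]; rewrite -!pred_Sn.
  have NE : (m - i.+1 + 1 - j.+1 + 1 = m + 2 - i.+1 - j.+1)%N. by lia.
  have NS : (m + 2 - i.+1 - j.+1 + (j + i) = m)%N. by lia.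
  have D2E : D2 V1 V2 V3 j i F = foldr (@dird R) F (nseq j (V1 - V2) ++ nseq i (V3 - V2)).
    by rewrite foldr_cat !foldr_nseq.
  have D3E : D3 V1 V2 V3 j i F = foldr (@dird R) F (nseq j (V1 - V3) ++ nseq i (V2 - V3)).
    by rewrite foldr_cat !foldr_nseq.
  rewrite D2E D3E NE.
  rewrite (Taylor_line (N := m + 2 - i.+1 - j.+1) D_convex DV1 DV2 CF lipF); last first.
    by rewrite size_cat !size_nseq.
  rewrite (Taylor_line (N := m + 2 - i.+1 - j.+1) D_convex DV1 DV3 CF lipF); last first.
    by rewrite size_cat !size_nseq.
  have step (a b S2 S3 r2 r3 S g : R) : a * S2 + b * S3 = S ->
      (a * (S2 + r2) + b * (S3 + r3)) * g = S * g + (a * r2 + b * r3) * g.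
    by move=> <-; ring.
  rewrite [RHS](_ : _ = (\sum_(1 <= k < (m + 2 - i.+1 - j.+1).+1)
      jet F (k + j + i) ((U ^+ (k + j) - W ^+ (k + j)) * (U - W) ^+ i) V1 / k`!%:R) *
      (bernSS i.+1 j.+1 l s / (i.+1`!%:R * j.+1`!%:R)) +
     ((-1) ^+ (i.+1 + j.+1) * remainder V1 (m + 2 - i.+1 - j.+1)
       (foldr (@dird R) F (nseq j (V1 - V2) ++ nseq i (V3 - V2))) V2
       + (-1) ^+ j.+1 * remainder V1 (m + 2 - i.+1 - j.+1)
       (foldr (@dird R) F (nseq j (V1 - V3) ++ nseq i (V2 - V3))) V3)
      * (bernSS i.+1 j.+1 l s / (i.+1`!%:R * j.+1`!%:R))); last first.
    by rewrite mulr_suml.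
  apply: step; rewrite !mulr_sumr -big_split/=; apply: eq_bigr => k _.
  rewrite !mulrA -!jetZ -mulrDl !size_cat !size_nseq addnA -jetD; congr (jet _ _ _ _ / _).
  rewrite !big_cat/= !big_nseq !iter_mulr_1.
  have -> : symbol (V1 - V2) = - U by rewrite /U !symbB opprB.
  have -> : symbol (V1 - V3) = - W by rewrite /W !symbB opprB.
  have -> : symbol (V3 - V2) = W - U by rewrite /U /W !symbB; ring.
  have -> : symbol (V2 - V3) = U - W by rewrite /U /W !symbB; ring.
  by rewrite sign_polyU sign_polyW mulrBl.
have -> : \sum_(1 <= j < m.+1)
    (D1 V1 V2 V3 0 j.-1 F V3 - D1 V1 V2 V3 0 j.-1 F V1) * ((bernS R j).[s] / j`!%:R) =
  \sum_(1 <= j < m.+1) \sum_(1 <= k < (m - j + 1).+1) A j k +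
  \sum_(1 <= j < m.+1)
    remainder V1 (m - j + 1) (D1 V1 V2 V3 0 j.-1 F) V3 * ((bernS R j).[s] / j`!%:R).
  by rewrite -big_split; apply: eq_big_nat => j /AE.
(* collect the terms of total degree n *)
rewrite sum_triangle.
set G := \sum_(1 <= i < m.+1) \sum_(1 <= j < (m - i + 1).+1) _.
set E2 := (X in _ = _ + (_ + X)).
have -> : G = \sum_(1 <= n < m.+1) \sum_(1 <= i < n.+1)
    \sum_(1 <= j < (n - i + 1).+1) B i j (n + 2 - i - j)%N + E2.
  rewrite /G /E2.
  transitivity (\sum_(1 <= i < m.+1) \sum_(1 <= q < (m - i + 1).+1)
      \sum_(1 <= j < q.+1) B i j (q + 1 - j)%N + E2).
    rewrite -big_split/=; apply: eq_big_nat => i im; rewrite -(sum_triangle (B i)).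
    by rewrite -big_split/=; apply: eq_big_nat => j; exact: BE.
  congr (_ + _); rewrite (sum_triangle (fun i q : nat => \sum_(1 <= j < q.+1) B i j (q + 1 - j)%N)).
  apply: eq_big_nat => n _; apply: eq_big_nat => i /andP[_ i_n].
  have -> : (n + 1 - i = n - i + 1)%N by lia.
  apply: eq_big_nat => j /andP[j1 jn].
  by have -> : (n - i + 1 + 1 - j = n + 2 - i - j)%N by lia.
have regroup (a b c d e t : R) : a + b + c = t -> a + (b + d) + (c + e) = t + (d + e).
  by move=> <-; ring.
apply: regroup.
have -> : f V1 = jet F 0 ((0`!%:R)^-1 *: symbol (x - V1) ^+ 0) V1.
  by rewrite /jet big_ord_recl big_ord0 addr0 /= fact0 invr1 scale1r coefC mul1r Ff.
rewrite [RHS]big_ord_recl -addrA; congr (_ + _).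
rewrite -big_split/= [LHS]big_add1 /= big_mkord; apply: eq_bigr => n _.
rewrite hE -bernoulli_exp_poly// jetD !jet_sum; congr (_ + _).
  apply: eq_big_nat => j /andP[j1 jn]; rewrite /A jetZ.
  have -> : (n.+1 + 1 - j + j.-1 = n.+1)%N by lia.
  by ring.
apply: eq_big_nat => i /andP[i1 i_n]; rewrite jet_sum.
apply: eq_big_nat => j /andP[j1 jn]; rewrite /B jetZ.
have E1 : (n.+1 + 2 - i - j + j.-1 = n.+1 + 1 - i)%N. by lia.
rewrite E1.
have -> : (n.+1 + 1 - i + i.-1 = n.+1)%N by lia.
by ring.
Qed.
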